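(* Let $k\geq 2$, $q\geq 0$ and $1\leq t\leq 2^q$ be integers and let $d=2^q(k+1)-t$. For any $2^{q+1}-1$ masses on $\mathbb{R}^d$, there exist $k$ hyperplanes $H_1,\dots,H_k$ in $\mathbb{R}^d$ such that (i) any two of $H_1,\dots,H_k$ equipartition each of some prescribed $2^{q+1}-t$ of the masses, and (ii) any two of $H_2,\dots,H_k$ equipartition each of the remaining $t-1$ masses.
   Context: A mass on $\mathbb{R}^d$ is a finite Borel measure on $\mathbb{R}^d$ absolutely continuous with respect to Lebesgue measure. A hyperplane $H=\{\langle u,a\rangle=b\}$ ($a\neq0$) has closed half-spaces $H^+=\{\langle u,a\rangle\geq b\}$, $H^-=\{\langle u,a\rangle\leq b\}$. Hyperplanes $H_{i},H_j$ equipartition $\mu$ if each of the four regions $H_i^{\pm}\cap H_j^{\pm}$ has $\mu$-measure $\mu(\mathbb{R}^d)/4$. *)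

(* Defs.v *)
(* R^d is modelled as d.-tuple R with the product
   (= Borel) sigma-algebra provided by MathComp-Analysis. *)
From HB Require Import structures.
From mathcomp Require Import all_boot all_order all_algebra.
From mathcomp Require Import all_classical all_reals all_analysis.
Set Implicit Arguments. Unset Strict Implicit. Unset Printing Implicit Defensive.
Import Order.TTheory GRing.Theory Num.Theory.
Local Open Scope classical_set_scope.
Local Open Scope ring_scope.

Definition box (R : realType) (d : nat) (a b : d.-tuple R) : set (d.-tuple R) :=
  [set u | forall i : 'I_d, tnth a i <= tnth u i < tnth b i].

Definition box_vol (R : realType) (d : nat) (a b : d.-tuple R) : R :=
  \prod_(i < d) (tnth b i - tnth a i).

Definition lebesgue_null (R : realType) (d : nat) (N : set (d.-tuple R)) : Prop :=
  forall eps : R, 0 < eps ->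
    exists (a b : nat -> d.-tuple R),
      (forall n (i : 'I_d), tnth (a n) i <= tnth (b n) i) /\
      N `<=` \bigcup_n box (a n) (b n) /\
      (\sum_(0 <= n <oo) (box_vol (a n) (b n))%:E <= eps%:E)%E.

Definition is_mass (R : realType) (d : nat)
    (mu : {measure set (d.-tuple R) -> \bar R}) : Prop :=
  (mu setT < +oo)%E /\
  forall A : set (d.-tuple R), measurable A -> lebesgue_null A -> mu A = 0%E.

Definition dotp (R : realType) (d : nat) (u a : d.-tuple R) : R :=
  \sum_(i < d) tnth u i * tnth a i.

(* A hyperplane {<u,a> = b} is encoded by the pair (a, b), with a <> 0. *)
Definition is_hyperplane (R : realType) (d : nat) (H : d.-tuple R * R) : Prop :=
  exists i : 'I_d, tnth H.1 i != 0.

Definition halfspace (R : realType) (d : nat) (s : bool) (H : d.-tuple R * R)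
  : set (d.-tuple R) :=
  if s then [set u | H.2 <= dotp u H.1] else [set u | dotp u H.1 <= H.2].

Definition equipartition (R : realType) (d : nat) (H1 H2 : d.-tuple R * R)
    (mu : {measure set (d.-tuple R) -> \bar R}) : Prop :=
  forall s1 s2 : bool,
    mu (halfspace s1 H1 `&` halfspace s2 H2) = (mu setT * (4%:R^-1)%:E)%E.

(* Main.v *)
(** Let the [i]-th hyperplane range over a hemisphere of dimension [d - i]. Its sign
integrals, and the products of two of them, against the masses are continuous functions
whose signs change under antipodes on the boundaries of the hemispheres. By a Borsuk-Ulam
theorem for products of projective spaces they have a common zero as soon as the monomial
[\prod_i u_i ^ (d - i)] has coefficient 1 modulo 2 in the product of the linear forms [u_i]
and [u_i + u_j] attached to the constraints. That product is [W0 ^ (2 ^ (q + 1) - t) *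
W1 ^ (t - 1)], where [W0] and [W1] are, up to a product of variables, Vandermonde
determinants; the two exponents have complementary binary digits, so by Frobenius it is a
product of [2 ^ j]-th powers of determinants, in which only one family of permutations
contributes to the monomial.

The Borsuk-Ulam theorem is proved on a cubical grid, by evaluating the cup product of the
coboundaries of the sign cochains on the flags of the grid: the result depends only on the
behaviour of the cochains under antipodes, and it is computed on coordinate cochains. A
flag on which it does not vanish carries a sign change of every function, and a limit of
such flags is a common zero. *)
Require Import Defs.
From HB Require Import structures.
From mathcomp Require Import all_boot all_order all_fingroup all_algebra.
From mathcomp Require Import all_classical all_reals all_analysis.
From mathcomp Require Import zify ring lra.
Set Implicit Arguments. Unset Strict Implicit. Unset Printing Implicit Defensive.

(** * Sums modulo 2 and fibres of maps *)

Lemma big_addb_involution (T : finType) (f : T -> T) (F : T -> bool) :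
  involutive f -> (forall x, f x != x) -> (forall x, F (f x) = F x) ->
  \big[addb/false]_x F x = false.
Proof.
move=> fK fN Ff; rewrite (bigID (fun x => enum_rank x < enum_rank (f x))) /=.
rewrite [X in _ (+) X](reindex_inj (inv_inj fK)) /=.
under [X in _ (+) X]eq_big => [x|x _].
  rewrite fK -leqNgt leq_eqVlt (inj_eq val_inj) (inj_eq enum_rank_inj).
  rewrite eq_sym (negPf (fN x)) orFb; over.
  rewrite Ff; over.
by rewrite addbb.
Qed.

Section Fibre.

Variables (T K : finType) (phi : T -> K).

Definition fibre (b : K) := [set j | phi j == b].

Lemma in_fibre b j : (j \in fibre b) = (phi j == b).
Proof. by rewrite inE. Qed.

Lemma sum_card_fibre : \sum_b #|fibre b| = #|T|.
Proof.
transitivity (\sum_b \sum_(j | phi j == b) 1).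
  by apply: eq_bigr => b _; rewrite -sum1_card; apply: eq_bigl => j; rewrite inE.
by rewrite -[RHS]sum1_card (partition_big phi predT).
Qed.

End Fibre.

(** * Cup products modulo 2 on a cubical grid *)

Section Grid.

Variables (m L : nat) (K : finType) (blk : 'I_m -> K).
Local Notation N := L.*2.

Definition gpoint := {ffun 'I_m -> nat}.
(* A flag of the cubical grid: the unit cube with lowest corner [c.1], and the
   order [c.2] in which the coordinates pass from their even to their odd end. *)
Definition flag := ({ffun 'I_m -> 'I_N} * 'S_m)%type.
(** Neighbouring unit intervals share an end of a definite parity, so reflecting a cube in one
    coordinate can change a single vertex of a flag. As [N] is even, only even ends meet the
    boundary. *)
Definition even_end (x : nat) := x + odd x.
Definition odd_end (x : nat) := x + ~~ odd x.
Definition vtx (c : flag) (l : nat) : gpoint :=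
  [ffun i => if c.2 i < l then odd_end (c.1 i) else even_end (c.1 i)].
Definition neg (b : K) (x : gpoint) : gpoint :=
  [ffun i => if blk i == b then N - x i else x i].
Definition bd (b : K) (x : gpoint) :=
  [forall i, x i <= N] && [exists i, (blk i == b) && ((x i == 0) || (x i == N))].
Definition tot (Phi : (nat -> gpoint) -> bool) :=
  \big[addb/false]_(c : flag) Phi (vtx c).
Definition indep (l : nat) (Phi : (nat -> gpoint) -> bool) :=
  forall V V', (forall i, i <= m -> i != l -> V i = V' i) -> Phi V = Phi V'.

Definition reflO (x : 'I_N) : 'I_N := insubd x (if odd x then x.-1 else x.+1).
(** At the two ends of the grid there is no interval beyond the even end, and [x] is fixed: by the
    truncated predecessor at 0, by the default of [insubd] at [N.-1]. *)
Definition reflE (x : 'I_N) : 'I_N := insubd x (if odd x then x.+1 else x.-1).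

Definition upd (w : {ffun 'I_m -> 'I_N}) i (y : 'I_N) : {ffun 'I_m -> 'I_N} :=
  [ffun j => if j == i then y else w j].

Local Ltac parity x := have := odd_double_half x; case: (odd x) => /=.

Lemma reflOE x : reflO x = (if odd x then x.-1 else x.+1) :> nat.
Proof.
by rewrite val_insubd; case: x => x /=; case: ifP => //; parity x; lia.
Qed.

Lemma reflEE x :
  reflE x = (if odd x then if x.+1 < N then x.+1 else x else x.-1) :> nat.
Proof.
rewrite val_insubd; case: x => x /= xN.
by case: (odd x) => //; case: ifP => //; lia.
Qed.

Lemma reflOK : involutive reflO.
Proof.
move=> x; apply: val_inj; rewrite /= reflOE.
by have := reflOE x; case: x => x /= xN; parity x; parity (reflO (Ordinal xN)); lia.
Qed.

Lemma reflEK : involutive reflE.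
Proof.
move=> x; apply: val_inj; rewrite /= reflEE.
have := reflEE x; case: x => x /= xN.
by parity x; case: ifP; parity (reflE (Ordinal xN)); try case: ifP; lia.
Qed.

Lemma reflO_neq x : reflO x != x.
Proof. by rewrite -val_eqE /= reflOE; parity x; lia. Qed.

Lemma reflO_end x : odd_end (reflO x) = odd_end x.
Proof.
rewrite /odd_end; have := reflOE x.
by case: x => x /= xN; parity x; parity (reflO (Ordinal xN)); lia.
Qed.

Lemma reflE_fix x : (reflE x == x) = (x == 0 :> nat) || (x == N.-1 :> nat).
Proof.
by rewrite -val_eqE /= reflEE; case: x => x /=; parity x; try case: ifP; lia.
Qed.

Lemma reflE_end x : reflE x != x -> even_end (reflE x) = even_end x.
Proof.
rewrite reflE_fix /even_end; have := reflEE x.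
case: x => x /= xN.
by parity x; try case: ifP; parity (reflE (Ordinal xN)); lia.
Qed.

Lemma rev_even_end (x : 'I_N) : even_end (rev_ord x) = N - even_end x.
Proof.
by rewrite /even_end; case: x => x /= xN; parity x; parity (N - x.+1); lia.
Qed.

Lemma rev_odd_end (x : 'I_N) : odd_end (rev_ord x) = N - odd_end x.
Proof.
by rewrite /odd_end; case: x => x /= xN; parity x; parity (N - x.+1); lia.
Qed.

Lemma vtx_le c l : [forall i, vtx c l i <= N].
Proof.
apply/forallP => i; rewrite ffunE /odd_end /even_end; case: (c.1 i) => x /= xN.
by case: ifP => _; parity x; lia.
Qed.

Lemma updK w i y : upd (upd w i y) i (w i) = w.
Proof. by apply/ffunP => j; rewrite !ffunE; case: eqP => // ->. Qed.

Lemma upd_at w i y : upd w i y i = y.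
Proof. by rewrite ffunE eqxx. Qed.

(** Reflecting the coordinate that moves first in its odd end alters vertex 0 alone and pairs the
    flags. Odd ends are interior, so there are no boundary terms. *)
Lemma tot_indep_bottom Phi : 0 < m -> indep 0 Phi -> tot Phi = false.
Proof.
move=> m0 ind; pose i0 (p : 'S_m) := (p^-1)%g (Ordinal m0).
pose f (c : flag) : flag := (upd c.1 (i0 c.2) (reflO (c.1 (i0 c.2))), c.2).
apply: (@big_addb_involution _ f) => [[w p]|[w p]|[w p]]; rewrite /f /=.
- by rewrite upd_at reflOK updK.
- rewrite xpair_eqE eqxx andbT; apply/eqP => /ffunP/(_ (i0 p)).
  by rewrite upd_at => /eqP; apply/negP/reflO_neq.
- apply: ind => l lm l0; apply/ffunP => i; rewrite !ffunE /=.
  case: eqP => // ->; have -> : p (i0 p) < l by rewrite /i0 permKV /= lt0n.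
  by rewrite reflO_end.
Qed.

(** Flags are paired by exchanging the coordinates that move just before and just after vertex
    [l.+1]. *)
Lemma tot_indep_middle l Phi : l.+1 < m -> indep l.+1 Phi -> tot Phi = false.
Proof.
move=> lm ind; have l'm := ltnW lm.
pose u := Ordinal l'm; pose v := Ordinal lm.
pose f (c : flag) : flag := (c.1, (c.2 * tperm u v)%g).
apply: (@big_addb_involution _ f) => [[w p]|[w p]|[w p]]; rewrite /f /=.
- by congr (_, _); apply/permP => i; rewrite !permM tpermK.
- rewrite xpair_eqE eqxx /=; apply/eqP => /permP/(_ ((p^-1)%g u)).
  rewrite permM permKV tpermL => /(congr1 val) /=; lia.
- apply: ind => i im il; apply/ffunP => x; rewrite !ffunE /= permM.
  by case: tpermP => [->|->|//] /=; congr (if _ then _ else _); lia.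
Qed.

(** The coordinate that moves last is reflected in its even end. If that end is on the boundary, so
    are all vertices below [m], and the flag is paired with its antipode in the block of that
    coordinate. *)
Lemma tot_indep_top Phi : 0 < m -> indep m Phi ->
  (forall b V, (forall j, j < m -> bd b (V j)) -> Phi (fun l => neg b (V l)) = Phi V) ->
  tot Phi = false.
Proof.
move=> m0 ind inv; have m1 : m.-1 < m by rewrite prednK.
pose i0 (p : 'S_m) := (p^-1)%g (Ordinal m1).
pose opp (c : flag) : flag :=
  ([ffun i => if blk i == blk (i0 c.2) then rev_ord (c.1 i) else c.1 i], c.2).
pose out (c : flag) := reflE (c.1 (i0 c.2)) == c.1 (i0 c.2).
pose f (c : flag) : flag :=
  if out c then opp c else (upd c.1 (i0 c.2) (reflE (c.1 (i0 c.2))), c.2).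
have oppK c : opp (opp c) = c.
  case: c => w p; rewrite /opp /=; congr (_, _); apply/ffunP => i; rewrite !ffunE.
  by case: (blk i == _); rewrite ?rev_ordK.
have out_opp c : out (opp c) = out c.
  rewrite /out /= ffunE eqxx !reflE_fix /=.
  by case: (c.1 _) => x /=; lia.
apply: (@big_addb_involution _ f) => c.
- rewrite {2}/f; case: ifP => oc; first by rewrite /f out_opp oc oppK.
  rewrite /f {1}/out /= upd_at reflEK eq_sym.
  by rewrite -/(out c) oc updK -surjective_pairing.
- rewrite /f; case: ifP => oc.
    rewrite /opp; case: c oc => w p; rewrite /out reflE_fix /= => oc.
    rewrite xpair_eqE eqxx andbT; apply/eqP => /ffunP/(_ (i0 p)).
    rewrite ffunE eqxx => /(congr1 val) /=.
    by case: (w _) oc => x /=; lia.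
  case: c oc => w p; rewrite /out /= => oc; rewrite xpair_eqE eqxx andbT.
  by apply/eqP => /ffunP/(_ (i0 p)); rewrite upd_at => /eqP; rewrite oc.
- rewrite /f; case: ifP => oc.
    rewrite -[RHS](inv (blk (i0 c.2))).
      apply: ind => l lm _; apply/ffunP => i; rewrite !ffunE /=.
      case: (blk i == _) => //; case: (_ < l); [exact: rev_odd_end|exact: rev_even_end].
    move=> j jm; rewrite /bd vtx_le; apply/existsP; exists (i0 c.2); rewrite eqxx ffunE /=.
    rewrite {1 3}/i0 permKV /= ltnNge -ltnS prednK // jm /=.
    move: oc; rewrite /out reflE_fix /even_end.
    by case: (c.1 _) => x /=; parity x; lia.
  apply: ind => l lm lNm; apply/ffunP => i; rewrite !ffunE /=.
  case: eqP => // ->; rewrite {1 4}/i0 permKV /=.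
  rewrite (_ : (m.-1 < l) = false); last lia.
  by rewrite reflE_end // -/(out c) oc.
Qed.

Lemma totD Phi Psi : tot (fun V => Phi V (+) Psi V) = tot Phi (+) tot Psi.
Proof. exact: big_split. Qed.

Lemma eq_tot Phi Psi : (forall V, Phi V = Psi V) -> tot Phi = tot Psi.
Proof. by move=> e; apply: eq_bigr => c _; rewrite e. Qed.

Definition ediff (s : 'I_m -> gpoint -> bool) (e : 'I_m -> nat) i (V : nat -> gpoint) :=
  s i (V (e i)) (+) s i (V (e i).+1).

(** The Alexander-Whitney cup product of the coboundaries of the [s i], evaluated on the sum of all
    flags. *)
Definition cup s := tot (fun V => \big[andb/true]_(i < m) ediff s val i V).

(** Antipodal identification on the boundaries turns the grid into a product of projective spaces.
    The coboundary of [f] descends to a cocycle whose class in degree 1 has coordinates [a]. *)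
Definition has_type (a : K -> bool) (f : gpoint -> bool) :=
  forall b x, bd b x -> f (neg b x) = f x (+) a b.

Section Slot.

Variables (s : 'I_m -> gpoint -> bool) (a : 'I_m -> K -> bool).
Hypothesis sa : forall i, has_type (a i) (s i).
Variables (h : gpoint -> bool) (j : 'I_m).
Hypothesis h0 : has_type (fun=> false) h.

Let shifted (v : nat) (e : 'I_m -> nat) V :=
  h (V v) && \big[andb/true]_(i < m | i != j) ediff s e i V.

(** The coboundaries of one cochain on two consecutive edges add up to a function of the outer
    vertices. If no other factor uses the middle vertex, [tot_indep_middle] applies to the sum. *)
Let shift_edge v (e e' : 'I_m -> nat) (i1 : 'I_m) : i1 != j ->
  (forall i, i != i1 -> e i = e' i) -> e' i1 = (e i1).+1 -> (e i1).+1 < m ->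
  v <= m -> v != (e i1).+1 -> (forall i, e i < m) ->
  (forall i, i != j -> i != i1 -> (e i != (e i1).+1) && (e i != e i1)) ->
  tot (shifted v e) = tot (shifted v e').
Proof.
move=> i1j ee' e'1 e1m vm vx em xN; apply: addbI (tot (shifted v e')) _ _ _.
rewrite addbb addbC -totD.
pose G V := h (V v) && (\big[andb/true]_(i < m | (i != j) && (i != i1)) ediff s e i V)
  && (s i1 (V (e i1)) (+) s i1 (V (e i1).+2)).
have EG V : shifted v e V (+) shifted v e' V = G V.
  rewrite /shifted /G !(bigD1 i1 i1j) /=.
  have -> : \big[andb/true]_(i < m | (i != j) && (i != i1)) ediff s e' i V =
            \big[andb/true]_(i < m | (i != j) && (i != i1)) ediff s e i V.
    by apply: eq_bigr => i /andP[_ /ee' ei]; rewrite /ediff ei.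
  rewrite /ediff e'1; case: (h _) => //=; case: (\big[_/_]_(_ | _) _); rewrite ?andbF //.
  by case: (s i1 _); case: (s i1 _); case: (s i1 _).
rewrite (eq_tot EG); apply: (@tot_indep_middle (e i1)) => // V V' VV'.
rewrite /G (VV' v) // (VV' (e i1)); [|lia..].
rewrite (VV' (e i1).+2); [|lia..].
congr (_ && _ && _); apply: eq_bigr => i /andP[ij ii1].
have /andP[h1 h2] := xN i ij ii1.
by have emi := em i; rewrite /ediff (VV' (e i)) 1?(VV' (e i).+1) //; lia.
Qed.

(* Edge [i] is moved down by one for [j < i <= l], which frees the vertex [l.+1]. *)
Let slot_left l : j <= l < m ->
  tot (shifted j (fun i => if j < i <= l then i.-1 else i)) = false.
Proof.
have [n] := ubnP (m - l); elim: n l => // n IH l ln /andP[jl lm].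
have [lm1|lm1] := ltnP l.+1 m.
  rewrite -[RHS](IH l.+1); [|lia..]; apply/esym.
  apply: (@shift_edge _ _ _ (Ordinal lm1)) => /=; try (repeat case: ifP; lia).
  - by rewrite -val_eqE /=; lia.
  - by move=> i; rewrite -val_eqE /= => il; congr (if _ then _ else _); lia.
  - by move=> i; case: ifP; have := ltn_ord i; lia.
  - by move=> i; rewrite -!val_eqE /=; have := ltn_ord i; repeat case: ifP; lia.
(* Now [l] is [m - 1] and vertex [m] is free; on the boundary, antipodes preserve [h] and all
   coboundaries. *)
have m0 : 0 < m by lia.
apply: tot_indep_top => // [V V' VV'|b V bdV]; rewrite /shifted.
- rewrite VV'; [|have := ltn_ord j; lia..]; congr (_ && _).
  apply: eq_bigr => i; rewrite -val_eqE /= /ediff => ij; have im := ltn_ord i.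
  by rewrite !VV' //; case: ifP; lia.
- rewrite h0 ?addbF; last by apply: bdV; have := ltn_ord j; lia.
  congr (_ && _); apply: eq_bigr => i; rewrite -val_eqE /= /ediff => ij.
  have im := ltn_ord i; rewrite !sa; [|apply: bdV; case: ifP; lia..].
  by rewrite addbACA addbb addbF.
Qed.

(** Mirror image of [slot_left]: the edges from [l] to [j - 1] move up, and at [l = 0] the vertex 0
    is free. *)
Let slot_right l : l <= j ->
  tot (shifted j.+1 (fun i => if l <= i < j then i.+1 else i)) = false.
Proof.
have jm := ltn_ord j; elim: l => [|l IH] lj.
  apply: tot_indep_bottom => [|V V' VV']; first lia.
  rewrite /shifted VV' //; congr (_ && _).
  apply: eq_bigr => i; rewrite -val_eqE /= /ediff => ij; have im := ltn_ord i.
  by rewrite !VV' //; case: ifP; lia.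
have lm : l < m by lia.
rewrite -[RHS]IH; last lia.
apply: (@shift_edge _ _ _ (Ordinal lm)) => /=; try (repeat case: ifP; lia).
- by rewrite -val_eqE /=; lia.
- by move=> i; rewrite -val_eqE /= => il; congr (if _ then _ else _); lia.
- by move=> i; case: ifP; have := ltn_ord i; lia.
- by move=> i; rewrite -!val_eqE /=; have := ltn_ord i; repeat case: ifP; lia.
Qed.

(** The two end values of [h] on edge [j] are treated separately: for the lower one the edges above
    [j] are pushed down, for the upper one the edges below [j] are pushed up. *)
Lemma cup_slot0 :
  tot (fun V => (h (V j) (+) h (V j.+1)) && \big[andb/true]_(i < m | i != j) ediff s val i V)
  = false.
Proof.
have jm := ltn_ord j.
have eqS v (e : 'I_m -> nat) : (forall i, e i = i) ->
    tot (shifted v e) = tot (shifted v val).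
  move=> ei; apply: eq_tot => V; congr (_ && _); apply: eq_bigr => i _.
  by rewrite /ediff ei.
under eq_tot do rewrite andb_addl.
rewrite (totD (shifted j val) (shifted j.+1 val)).
rewrite -(eqS j (fun i => if j < i <= j then i.-1 else i)) ?slot_left ?leqnn //.
  rewrite -(eqS j.+1 (fun i => if j <= i < j then i.+1 else i)) ?slot_right //.
  by move=> i; case: ifP; lia.
by move=> i; case: ifP; lia.
Qed.

End Slot.

(** The cochains are exchanged one at a time; two of the same type differ by one of type zero, to
    which [cup_slot0] applies. *)
Lemma cup_type s s' (a : 'I_m -> K -> bool) :
  (forall i, has_type (a i) (s i)) -> (forall i, has_type (a i) (s' i)) ->
  cup s = cup s'.
Proof.
move=> sa sa'; pose r l (i : 'I_m) := if (i < l)%N then s' i else s i.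
have ra l i : has_type (a i) (r l i) by rewrite /r; case: ifP.
suff H l : l <= m -> cup (r l) = cup s.
  rewrite -(H m (leqnn m)); apply: eq_tot => V; apply: eq_bigr => i _.
  by rewrite /ediff /r ltn_ord.
elim: l => [|l IH] lm; first by apply: eq_tot => V; apply: eq_bigr.
rewrite -IH ?(ltnW lm) //; pose j := Ordinal lm.
apply: addbI (cup (r l)) _ _ _; rewrite addbb addbC -totD.
pose h x := s j x (+) s' j x.
rewrite -[RHS](@cup_slot0 _ _ (ra l) h j); last first.
  by move=> b x bx; rewrite /h sa // sa' // addbACA addbb.
apply: eq_tot => V; rewrite [X in X (+) _](bigD1 j) // [X in _ (+) X](bigD1 j) //=.
have -> : \big[andb/true]_(i < m | i != j) ediff (r l.+1) val i V =
          \big[andb/true]_(i < m | i != j) ediff (r l) val i V.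
  apply: eq_bigr => i; rewrite -val_eqE /ediff /r /= => il.
  by rewrite ltnS leq_eqVlt (negPf il).
rewrite -andb_addl; congr (_ && _); rewrite /ediff /r /h /= ltnn ltnSn.
by case: (s' j _); case: (s' j _); case: (s j _); case: (s j _).
Qed.

Definition at_bd (b : K) (x : gpoint) i := (blk i == b) && ((x i == 0) || (x i == N)).
(** The picked index depends only on the set of coordinates at an end, which antipodes preserve;
    this makes the sign odd. *)
Definition sgn_bd (b : K) (x : gpoint) :=
  if [pick i | at_bd b x i] is Some i then x i == N else false.
(** Represents the class of block [b] by the hyperplane at infinity of its projective space. *)
Definition infty (b : K) (x : gpoint) := bd b x && sgn_bd b x.
(** Represents the same class by the hyperplane [x i = L]. There the antipode fixes [x i], so on the
    boundary [sgn_bd] breaks the tie. *)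
Definition coord (i : 'I_m) (x : gpoint) :=
  if (x i == L) && bd (blk i) x then sgn_bd (blk i) x else L < x i.

Lemma neg_le b (x : gpoint) : [forall i, x i <= N] -> [forall i, neg b x i <= N].
Proof.
move=> /forallP xN; apply/forallP => i; rewrite ffunE.
by case: ifP => _; rewrite ?leq_subr.
Qed.

Lemma at_bd_neg b b' (x : gpoint) : [forall i, x i <= N] -> at_bd b (neg b' x) =1 at_bd b x.
Proof.
move=> /forallP xN i; rewrite /at_bd ffunE; case: (blk i == b) => //=.
by case: (blk i == b') => //=; have := xN i; lia.
Qed.

Lemma bd_neg b b' x : bd b' x -> bd b (neg b' x) = bd b x.
Proof.
move=> /andP[xN _]; rewrite /bd neg_le // xN /=.
by apply: eq_existsb => i; apply: at_bd_neg.
Qed.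

Lemma sgn_bd_neg b b' x : 0 < L -> bd b' x -> bd b x ->
  sgn_bd b (neg b' x) = sgn_bd b x (+) (b' == b).
Proof.
move=> L0 /andP[xN _] /andP[_ /existsP[i0 i0b]].
rewrite /sgn_bd (eq_pick (at_bd_neg b b' xN)).
have [i /andP[/eqP ib xi]|no] := pickP (at_bd b x); last by have := no i0; rewrite /at_bd i0b.
have := forallP xN i; rewrite ffunE ib [b == b']eq_sym; case: (b' == b) => /=;
  last by rewrite addbF.
by rewrite addbT; move: xi; lia.
Qed.

Lemma infty_type b : 0 < L -> has_type (pred1 b) (infty b).
Proof.
move=> L0 b' x bx; rewrite /infty bd_neg //=.
case: (boolP (bd b x)) => [bbx|nb] /=; first exact: sgn_bd_neg.
by case: eqP => // e; rewrite -e bx in nb.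
Qed.

Lemma coord_type i : 0 < L -> has_type (pred1 (blk i)) (coord i).
Proof.
move=> L0 b' x bx; rewrite /coord bd_neg //= ffunE.
have := forallP (proj1 (andP bx)) i; rewrite [b' == _]eq_sym.
case: (blk i =P b') => [e|ne] xi; last first.
  rewrite addbF; case: ifP => // /andP[_ h]; rewrite sgn_bd_neg //.
  by rewrite (_ : (b' == blk i) = false) ?addbF //; apply/eqP => e; case: ne.
move: bx; rewrite -e => bx; rewrite bx !andbT sgn_bd_neg // eqxx.
by do 2 case: eqP => ? //; rewrite ?addbT; lia.
Qed.

Lemma coord_near i (c : flag) l :
  coord i (vtx c l) != coord i (vtx c l.+1) -> L.-1 <= c.1 i <= L.
Proof.
apply: contraNT => far.
suff H l' : coord i (vtx c l') = (L <= c.1 i) by rewrite !H.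
rewrite /coord ffunE /odd_end /even_end; move: far.
by parity (c.1 i); case: (c.2 i < l') => /=; case: eqP => /= h; lia.
Qed.

Lemma near_bdF b (c : flag) l : 2 < L -> (forall i, blk i = b -> L.-1 <= c.1 i <= L) ->
  bd b (vtx c l) = false.
Proof.
move=> L2 near; apply/negP => /andP[_ /existsP[i /andP[/eqP ib]]].
have := near i ib; rewrite ffunE /odd_end /even_end.
by parity (c.1 i); case: (c.2 i < l) => /=; lia.
Qed.

Lemma diff_neq (s : 'I_m -> gpoint -> bool) (e : 'I_m -> nat) i V :
  ediff s e i V = (s i (V (e i)) != s i (V (e i).+1)).
Proof. by rewrite /ediff; case: (s i _); case: (s i _). Qed.

(** The coordinate hyperplanes of block [b] meet only near its centre, so no flag crosses all of
    them and also the hyperplane at infinity. *)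
Lemma cup_infty s b : 2 < L -> (forall i, blk i = b -> exists j, s j = coord i) ->
  (exists j, s j = infty b) -> cup s = false.
Proof.
move=> L2 sb [j sj]; apply: big1 => c _; apply/negP; rewrite big_andE => /forallP all_diff.
have near i : blk i = b -> L.-1 <= c.1 i <= L.
  by move=> /sb[j' sj']; have := all_diff j'; rewrite /= diff_neq sj'; apply: coord_near.
by have := all_diff j; rewrite /= diff_neq sj /infty !near_bdF.
Qed.

(** As [L] is even, the interval from [L - 1] to [L] stays below the threshold and only the one from
    [L] to [L + 1] crosses it. *)
Lemma crossing w p j : ~~ odd L -> L.-1 <= w <= L ->
  (L < (if p < j then odd_end w else even_end w)) !=
    (L < (if p < j.+1 then odd_end w else even_end w)) -> (w == L) && (p == j).
Proof.
move=> Lev wL; have [->|wL1] : w = L \/ w.+1 = L by lia.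
  rewrite /odd_end /even_end (negPf Lev) eqxx /= ltnS.
  by case: (ltngtP p j) => /= _; rewrite ?eqxx.
have ow : odd w by move: Lev; rewrite -wL1 /= negbK.
by rewrite /odd_end /even_end ow /= -wL1; do 2 case: ifP => _; rewrite ?eqxx //; lia.
Qed.

(** The hyperplanes meet in a single flag: the cube with all corner coordinates [L], whose
    coordinates move in the order [sigma]. *)
Lemma cup_coord (sigma : 'S_m) : 2 < L -> ~~ odd L -> cup (fun j => coord (sigma j)) = true.
Proof.
move=> L2 Lev; have LN : L < N by lia.
pose c0 : flag := ([ffun=> Ordinal LN], (sigma^-1)%g).
rewrite /cup /tot (bigD1 c0) //= [X in _ (+) X]big1 => [|c cc0]; last first.
  apply/negP; rewrite big_andE => /forallP all_diff; case/eqP: cc0.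
  have near i : L.-1 <= c.1 i <= L.
    have := all_diff ((sigma^-1)%g i); rewrite /= diff_neq permKV.
    exact: coord_near.
  have H j : (c.1 (sigma j) == L :> nat) && (c.2 (sigma j) == j :> nat).
    have := all_diff j; rewrite /= diff_neq /coord !near_bdF // !andbF !ffunE.
    exact: crossing (near (sigma j)).
  case: c {all_diff near} H => w p H; congr (_, _).
    apply/ffunP => i; apply: val_inj; rewrite ffunE /=.
    by have /andP[/eqP] := H ((sigma^-1)%g i); rewrite permKV.
  apply/permP => i; apply: val_inj => /=.
  by have /andP[_ /eqP] := H ((sigma^-1)%g i); rewrite permKV.
rewrite addbF big_andE; apply/forallP => j /=.
rewrite diff_neq /coord !near_bdF //; first last.
- by move=> i _; rewrite ffunE /=; lia.
- by move=> i _; rewrite ffunE /=; lia.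
rewrite !andbF !ffunE /= permK ltnn ltnSn /odd_end /even_end (negPf Lev); lia.
Qed.

(** By [cup_type], the copies of [infty b] may be replaced by the coordinates of block [b], in
    order, while these last. If the sizes match, each coordinate is used once; otherwise some fibre
    is too large and [cup_infty] applies. *)
Lemma cup_fibres (phi : 'I_m -> K) : 2 < L -> ~~ odd L ->
  cup (fun j => infty (phi j)) = [forall b, #|fibre phi b| == #|fibre blk b|].
Proof.
move=> L2 Lev; have L0 : 0 < L by lia.
pose r j := index j (enum (fibre phi (phi j))).
pose sigma j := nth j (enum (fibre blk (phi j))) (r j).
pose s j := if r j < #|fibre blk (phi j)| then coord (sigma j) else infty (phi j).
have sum_fibre (psi : 'I_m -> K) : \sum_b #|fibre psi b| = m.
  by rewrite sum_card_fibre card_ord.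
have blk_sigma j : r j < #|fibre blk (phi j)| -> blk (sigma j) = phi j.
  rewrite cardE => rj; have := mem_nth j rj.
  by rewrite mem_enum inE => /eqP.
have r_lt j : r j < #|fibre phi (phi j)|.
  by rewrite cardE index_mem mem_enum inE.
have r_nth b n j0 : n < #|fibre phi b| ->
    let j := nth j0 (enum (fibre phi b)) n in phi j = b /\ r j = n.
  rewrite cardE => nb j; have := mem_nth j0 nb; rewrite mem_enum inE => /eqP jb.
  by split => //; rewrite /r jb index_uniq // enum_uniq.
transitivity (cup s).
  apply: (@cup_type _ _ (fun j => pred1 (phi j))) => j; first exact: infty_type.
  rewrite /s; case: ifP => [/blk_sigma <-|_]; [exact: coord_type|exact: infty_type].
case: forallP => [eq_card|neq_card].
  have r_blk j : r j < #|fibre blk (phi j)| by rewrite -(eqP (eq_card _)).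
  have inj_sigma : injective sigma.
    move=> j j' e; have pe : phi j = phi j' by rewrite -(blk_sigma j) // e blk_sigma.
    have re : r j = r j'.
      apply/eqP; rewrite -(@nth_uniq _ j (enum (fibre blk (phi j)))) ?enum_uniq //.
      - apply/eqP; move: e; rewrite /sigma -pe => ->; apply: set_nth_default.
        by rewrite -cardE pe.
      - by rewrite -cardE.
      - by rewrite -cardE pe.
    have jin : j \in enum (fibre phi (phi j)) by rewrite mem_enum inE.
    have j'in : j' \in enum (fibre phi (phi j)) by rewrite mem_enum inE pe.
    by rewrite -(nth_index j jin) -(nth_index j j'in) -/(r j) re /r pe.
  rewrite -(cup_coord (perm inj_sigma) L2 Lev).
  apply: eq_tot => V; apply: eq_bigr => j _.
  by rewrite /ediff /s r_blk permE.
have [b lt_b] : exists b, #|fibre blk b| < #|fibre phi b|.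
  apply/existsP; case: (boolP [exists b, _]) => // /existsPn le_card; case: neq_card => b.
  have le_b b' : #|fibre phi b'| <= #|fibre blk b'| by rewrite leqNgt le_card.
  rewrite eqn_leq le_b /= -(leq_add2r (\sum_(b' | b' != b) #|fibre phi b'|)).
  have := sum_fibre phi; rewrite (bigD1 b) //= => ->.
  rewrite -[leqRHS](sum_fibre blk) [leqRHS](bigD1 b) //= leq_add2l.
  exact: leq_sum.
have [j0 _] : exists j0, j0 \in fibre phi b by apply/card_gt0P; lia.
apply: (@cup_infty s b) => // [i ib|].
  have iin : i \in enum (fibre blk b) by rewrite mem_enum inE ib.
  have ilt : index i (enum (fibre blk b)) < #|fibre blk b| by rewrite cardE index_mem.
  have [jb rj] := r_nth b _ j0 (ltn_trans ilt lt_b).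
  exists (nth j0 (enum (fibre phi b)) (index i (enum (fibre blk b)))).
  by rewrite /s rj jb ilt /sigma jb rj nth_index.
have [jb rj] := r_nth b _ j0 lt_b.
by exists (nth j0 (enum (fibre phi b)) #|fibre blk b|); rewrite /s rj jb ltnn.
Qed.

Definition default (a : K -> bool) (x : gpoint) := \big[addb/false]_b (a b && infty b x).

Lemma default_type a : 0 < L -> has_type a (default a).
Proof.
move=> L0 b x bx; rewrite /default.
under eq_bigr do rewrite (infty_type _ L0) // andb_addr.
rewrite big_split /=; congr (_ (+) _).
rewrite (bigD1 b) //= eqxx andbT big1 ?addbF // => b'.
by rewrite eq_sym => /negPf->; rewrite andbF.
Qed.

(** With every cochain replaced by the default one of its type, the cup product expands
    multilinearly; [phi] chooses a block for each factor. *)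
Lemma cup_count s (a : 'I_m -> K -> bool) : 2 < L -> ~~ odd L ->
  (forall j, has_type (a j) (s j)) ->
  cup s = \big[addb/false]_(phi : {ffun 'I_m -> K})
    ([forall j, a j (phi j)] && [forall b, #|fibre phi b| == #|fibre blk b|]).
Proof.
move=> L2 Lev sa; have L0 : 0 < L by lia.
rewrite (@cup_type s (fun j => default (a j)) a) // => [|j]; last exact: default_type.
rewrite /cup /tot; under eq_bigr => c _.
  under eq_bigr => j _ do rewrite /ediff /default -big_split /=.
  rewrite bigA_distr_bigA /=; over.
rewrite exchange_big /=; apply: eq_bigr => phi _.
rewrite -cup_fibres //.
rewrite (_ : [forall j, _] = \big[andb/true]_j a j (phi j)); last by rewrite big_andE.
under eq_bigr => c _.
  under eq_bigr => j _ do rewrite -andb_addr.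
  rewrite big_split /=; over.
by rewrite -big_distrr.
Qed.

End Grid.

(** * The coefficient of the monomial modulo 2 *)

Section Counting.
Import GRing.Theory.
Local Open Scope ring_scope.

Lemma digits_inj B k (e f : 'I_k -> nat) :
  (forall i, e i < B)%N -> (forall i, f i < B)%N ->
  (\sum_i e i * B ^ i == \sum_i f i * B ^ i)%N = [forall i, e i == f i].
Proof.
elim: k e f => [|k IH] e f eB fB.
  by rewrite !big_ord0 eqxx; apply/esym/forallP => -[].
have B0 : (0 < B)%N by apply: leq_ltn_trans (eB ord0).
have split g : (\sum_(i < k.+1) g i * B ^ i =
    (\sum_(i < k) g (lift ord0 i) * B ^ i) * B + g ord0)%N.
  rewrite big_ord_recl expn0 muln1 addnC big_distrl /=; congr addn.
  by apply: eq_bigr => i _; rewrite /= expnS mulnCA mulnC.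
rewrite !split; apply/eqP/forallP => [H i|H]; last first.
  by rewrite (eqP (H ord0)); congr (_ * _ + _)%N; apply: eq_bigr => i _; rewrite (eqP (H _)).
have H0 : e ord0 = f ord0.
  by have := congr1 (modn^~ B) H; rewrite /= !modnMDl !modn_small.
have /eqP H1 : (\sum_(i < k) e (lift ord0 i) * B ^ i = \sum_(i < k) f (lift ord0 i) * B ^ i)%N.
  by have := congr1 (divn^~ B) H; rewrite /= !divnMDl // !divn_small // !addn0.
have [j ->|->] := unliftP ord0 i; last exact/eqP.
by rewrite IH // in H1; exact: (forallP H1).
Qed.

Lemma natr_F2_inj (a b : bool) : (a : nat)%:R = (b : nat)%:R :> 'F_2 -> a = b.
Proof. by case: a; case: b. Qed.

Lemma natr_addb (I : finType) (P : pred I) (F : I -> bool) :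
  ((\big[addb/false]_(i | P i) F i : nat)%:R : 'F_2) = \sum_(i | P i) (F i : nat)%:R.
Proof.
apply: (big_morph (fun b : bool => (b : nat)%:R : 'F_2)) => //.
by case; case; apply: val_inj.
Qed.

Section Kronecker.

Variables (k B : nat).
(* Powers of a single variable keep track of all exponents below [B]
   (Kronecker substitution). *)
Definition kvar (b : 'I_k) : {poly 'F_2} := 'X^(B ^ b).

Lemma prod_kvar (e : 'I_k -> nat) : \prod_b kvar b ^+ e b = 'X^(\sum_b e b * B ^ b)%N.
Proof.
rewrite (big_morph (fun n => 'X^n : {poly 'F_2}) (exprD 'X) (expr0 'X)).
by apply: eq_bigr => b _; rewrite /kvar -exprM mulnC.
Qed.

(** Expanding the product chooses a variable [phi j] from each form; by [digits_inj] distinct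
    monomials keep distinct exponents. *)
Lemma coef_prod_forms (J : finType) (alpha : J -> pred 'I_k) (n : 'I_k -> nat) :
  (#|J| < B)%N -> (forall b, n b < B)%N ->
  (\prod_j \sum_(b | alpha j b) kvar b)`_(\sum_b n b * B ^ b)%N =
  (\big[addb/false]_(phi : {ffun J -> 'I_k})
    ([forall j, alpha j (phi j)] && [forall b, #|fibre phi b| == n b]) : nat)%:R.
Proof.
move=> JB nB; rewrite bigA_distr_big_dep /= coef_sum natr_addb.
rewrite big_mkcond /=; apply: eq_bigr => phi _.
have -> : (phi \in family alpha) = [forall j, alpha j (phi j)] by [].
case: (boolP [forall j, _]) => //= _.
have -> : \prod_j kvar (phi j) = \prod_b kvar b ^+ #|fibre phi b|.
  rewrite (partition_big phi predT) //=; apply: eq_bigr => b _.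
  rewrite (eq_bigr (fun=> kvar b)) => [|j /eqP->//].
  by rewrite big_const -cardsE iter_mulr_1.
rewrite prod_kvar coefXn digits_inj // => [|b]; last first.
  exact: leq_ltn_trans (max_card _) JB.
by congr (_%:R); congr nat_of_bool; apply: eq_forallb => b; rewrite eq_sym.
Qed.

End Kronecker.

Section CharTwo.

Variable R : comNzRingType.
Hypothesis char2 : 2%N \in [pchar R].

Lemma sum_expr_2pow (I : finType) (P : pred I) (F : I -> R) n :
  (\sum_(i | P i) F i) ^+ (2 ^ n) = \sum_(i | P i) F i ^+ (2 ^ n).
Proof.
apply: (big_morph (fun x => x ^+ (2 ^ n))) => [x y|]; last by rewrite expr0n expn_eq0.
elim: n => [|n IH]; first by rewrite !expr1.
by rewrite expnSr !exprM IH sqrrD mulr2n (addrr_pchar2 char2) addr0.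
Qed.

(** Leibniz expansion of the Vandermonde determinant; the signs disappear in characteristic 2. *)
Lemma vandermonde_sum n (a : 'I_n -> R) :
  \prod_(i < n) \prod_(j < n | (i < j)%N) (a j + a i) = \sum_(s : 'S_n) \prod_i a i ^+ s i.
Proof.
have := det_Vandermonde (\row_i a i); rewrite -det_tr => H.
transitivity (\det (Vandermonde n (\row_i a i))^T).
  rewrite H; apply: eq_bigr => i _; apply: eq_bigr => j _.
  by rewrite !mxE (GRing.subr_pchar2 char2).
apply: eq_bigr => s _; rewrite -signr_odd; case: (odd _); rewrite ?expr1 ?mulN1r ?mul1r.
  rewrite (GRing.oppr_pchar2 char2); apply: eq_bigr => i _; by rewrite !mxE.
by apply: eq_bigr => i _; rewrite !mxE.
Qed.

Variables (k : nat) (u : 'I_k.+1 -> R).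

(** Summing over the set of the two indices makes the diagonal form [u i] and not
    [u i + u i = 0]. *)
Definition pair_form (i l : 'I_k.+1) : R := \sum_(b | (b == i) || (b == l)) u b.

Lemma pair_form_diag i : pair_form i i = u i.
Proof. by rewrite /pair_form (eq_bigl (pred1 i)) ?big_pred1_eq // => b; rewrite orbb. Qed.

Lemma pair_form_neq i l : i != l -> pair_form i l = u l + u i.
Proof.
move=> il; rewrite /pair_form (bigD1 l) ?eqxx ?orbT //=; congr (_ + _).
rewrite (eq_bigl (pred1 i)) ?big_pred1_eq // => b /=.
by case: (b =P i) => [->|_] //=; case: eqP.
Qed.

Lemma prod_pair_form (P : pred 'I_k.+1) :
  \prod_(i | P i) \prod_(l : 'I_k.+1 | (i <= l)%N) pair_form i l =
  (\prod_(i | P i) u i) * \prod_(i | P i) \prod_(l : 'I_k.+1 | (i < l)%N) (u l + u i).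
Proof.
rewrite -big_split /=; apply: eq_bigr => i _.
rewrite (bigD1 i) //= pair_form_diag; congr (_ * _); apply: eq_big => [l|l /andP[_ il]].
  by rewrite ltn_neqAle -val_eqE eq_sym andbC.
by rewrite pair_form_neq // eq_sym.
Qed.

Lemma all_pair_forms :
  \prod_(i : 'I_k.+1) \prod_(l : 'I_k.+1 | (i <= l)%N) pair_form i l =
  \sum_(s : 'S_k.+1) \prod_i u i ^+ (s i).+1.
Proof.
rewrite (prod_pair_form predT) vandermonde_sum big_distrr /=.
by apply: eq_bigr => s _; rewrite -big_split; apply: eq_bigr => i _; rewrite exprS.
Qed.

(* Setting the variable of index 0 to zero in the Vandermonde determinant. *)
Lemma positive_pair_forms :
  \prod_(i : 'I_k.+1 | (0 < i)%N) \prod_(l : 'I_k.+1 | (i <= l)%N) pair_form i l =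
  \sum_(s : 'S_k.+1 | s ord0 == ord0) \prod_i u i ^+ s i.
Proof.
rewrite prod_pair_form; pose a i := if i == ord0 then 0 else u i.
transitivity (\prod_(i : 'I_k.+1) \prod_(j : 'I_k.+1 | (i < j)%N) (a j + a i)).
  rewrite [RHS](bigD1 ord0) //=; congr (_ * _).
    by apply: eq_bigr => i i0; rewrite /a eqxx addr0 ifN // -val_eqE -lt0n.
  apply: eq_big => [i|i i0]; first by rewrite lt0n -val_eqE.
  apply: eq_bigr => l il; rewrite /a !ifN // -val_eqE /= -lt0n //.
  exact: ltn_trans il.
rewrite vandermonde_sum [RHS]big_mkcond; apply: eq_bigr => s _ /=.
rewrite (bigD1 ord0) //= /a eqxx expr0n; case: (s ord0 =P ord0) => [s0|/eqP s0].
  rewrite s0 mul1r [RHS](bigD1 ord0) //= s0 mul1r.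
  by apply: eq_bigr => i i0; rewrite ifN.
by rewrite (_ : (s ord0 == 0 :> nat) = false) ?mul0r //; apply: negPf.
Qed.

End CharTwo.

(** Halving splits off the lowest digits: the sum is odd at each stage, so exactly one of [A] and
    [C] is odd. The bound on [C] gives the top digit to [A]. *)
Lemma binary_split q (A C : nat) : (A + C = 2 ^ q.+1 - 1)%N -> (C < 2 ^ q)%N ->
  exists bit : 'I_q.+1 -> bool, [/\ bit ord_max,
    A = (\sum_j bit j * 2 ^ j)%N & C = (\sum_j ~~ bit j * 2 ^ j)%N].
Proof.
elim: q A C => [|q IH] A C AC Cq.
  exists (fun=> true); rewrite !big_ord_recl !big_ord0 /=; split=> //; lia.
have AC' : (A./2 + C./2 = 2 ^ q.+1 - 1)%N.
  have := odd_double_half A; have := odd_double_half C; rewrite [(2 ^ q.+2)%N]expnS in AC.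
  have : (0 < 2 ^ q.+1)%N by rewrite expn_gt0.
  by case: (odd A); case: (odd C) => /=; lia.
have [|bit [bq eA eC]] := IH _ _ AC'.
  by rewrite expnS in Cq; have := odd_double_half C; lia.
have oAC : odd C = ~~ odd A.
  have := odd_double_half A; have := odd_double_half C; rewrite [(2 ^ q.+2)%N]expnS in AC.
  have : (0 < 2 ^ q.+1)%N by rewrite expn_gt0.
  by case: (odd A); case: (odd C) => /=; lia.
exists (fun j => if unlift ord0 j is Some i then bit i else odd A); split.
- by case: unliftP => [j /(congr1 val) /= [jq]|/(congr1 val)//];
    rewrite (_ : j = ord_max) //; apply: val_inj.
- rewrite big_ord_recl unlift_none expn0 muln1 -[LHS]odd_double_half; congr addn.
  rewrite -mul2n eA big_distrr /=; apply: eq_bigr => i _.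
  by rewrite liftK expnS mulnCA.
- rewrite big_ord_recl unlift_none expn0 muln1 -oAC -[LHS]odd_double_half; congr addn.
  rewrite -mul2n eC big_distrr /=; apply: eq_bigr => i _.
  by rewrite liftK expnS mulnCA.
Qed.

(** The only family that contributes to the monomial: the reversal at the leading digit, the
    identity at the others. *)
Definition id_rev_perms q k (j : 'I_q.+1) : 'S_k.+1 :=
  if j == ord_max then perm (@rev_ord_inj k.+1) else 1%g.

Lemma sum_2pow q : (\sum_(j < q) 2 ^ j = 2 ^ q - 1)%N.
Proof.
elim: q => [|q IH]; first by rewrite big_ord0.
by rewrite big_ord_recr /= IH expnS; have : (0 < 2 ^ q)%N; rewrite ?expn_gt0 //; lia.
Qed.

Lemma id_rev_perms_sum q k (i : 'I_k.+1) :
  (\sum_(j < q.+1) id_rev_perms k j i * 2 ^ j = 2 ^ q * k - i)%N.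
Proof.
rewrite big_ord_recr /= /id_rev_perms eqxx permE /= subSS.
rewrite (eq_bigr (fun j : 'I_q => i * 2 ^ j)%N) => [|j _]; last first.
  by rewrite -val_eqE /= ltn_eqF // perm1.
rewrite -big_distrr /= sum_2pow; have ik : (i <= k)%N by rewrite -ltnS.
case: (2 ^ q)%N (expn_gt0 2 q) => // p _; rewrite -{2}(subnK ik); nia.
Qed.

(** Here [Q] stands for [2 ^ q] and [X] for the joint weight of the permutations before the last. *)
Lemma weight_le Q k i l X : (0 < Q)%N -> (i <= k)%N -> (l <= k)%N ->
  (i * Q - i <= X)%N -> (X + (k - i) * Q = Q * k - l)%N -> (l <= i)%N.
Proof.
case: Q => // p _ ik lk; rewrite mulnS addKn => iX e.
have : (i * p + (k - i) * p.+1 + l <= p.+1 * k)%N.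
  by have : (l <= p.+1 * k)%N; [nia|lia].
rewrite -{2}(subnK ik); nia.
Qed.

Lemma weight_eq Q k i X : (0 < Q)%N -> (i <= k)%N ->
  (X + (k - i) * Q = Q * k - i)%N -> X = (i * Q - i)%N.
Proof. by case: Q => // p _ ik; rewrite -{2}(subnK ik); nia. Qed.

(* At stage [i] look at the index [l] which the last permutation sends to [k - i]:
   the equation for [l] leaves no room for the other permutations. *)
Lemma id_rev_perms_unique q k (S : 'I_q.+1 -> 'S_k.+1) :
  (forall i, \sum_j S j i * 2 ^ j = 2 ^ q * k - i)%N -> S =1 id_rev_perms k.
Proof.
move=> HS; have q0 : (0 < 2 ^ q)%N by rewrite expn_gt0.
have HS' i : (\sum_(j < q) S (widen_ord (leqnSn q) j) i * 2 ^ j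
    + S ord_max i * 2 ^ q = 2 ^ q * k - i)%N.
  by rewrite -HS big_ord_recr.
suff H n (i : 'I_k.+1) : (i < n)%N -> S ord_max i = rev_ord i /\
    forall j : 'I_q, S (widen_ord (leqnSn q) j) i = i.
  move=> j; apply/permP => i; have [H1 H2] := H k.+1 i (ltn_ord i).
  rewrite /id_rev_perms; case: (j =P ord_max) => [->|/eqP jq]; first by rewrite permE.
  have jlt : (j < q)%N by rewrite ltn_neqAle -ltnS ltn_ord andbT.
  by rewrite perm1 -[RHS](H2 (Ordinal jlt)); congr (S _ _); apply: val_inj.
elim: n i => // n IH i; rewrite ltnS leq_eqVlt => /orP[/eqP iln|/IH //].
pose l := ((S ord_max)^-1)%g (rev_ord i).
have Sl : S ord_max l = rev_ord i by rewrite permKV.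
(* By induction the permutations are already known on indices below [i]; injectivity excludes [l]
   and its images from that range. *)
have il : (i <= l)%N.
  rewrite leqNgt; apply/negP => li; have [|Hl _] := IH l; first by rewrite -iln.
  by have := rev_ord_inj (etrans (esym Hl) Sl) => /(congr1 val) /=; lia.
have Sjl j : (i <= S (widen_ord (leqnSn q) j) l)%N.
  rewrite leqNgt; apply/negP => li.
  have [|_ Hl] := IH (S (widen_ord (leqnSn q) j) l); first by rewrite -iln.
  have := perm_inj (Hl j) => /(congr1 val) /=; lia.
have lk : (l <= k)%N by rewrite -ltnS.
have ik : (i <= k)%N by rewrite -ltnS.
have tot_l := HS' l; rewrite Sl /= subSS in tot_l.
have low : (\sum_(j < q) i * 2 ^ j <=
    \sum_(j < q) S (widen_ord (leqnSn q) j) l * 2 ^ j)%N.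
  by apply: leq_sum => j _; rewrite leq_mul2r Sjl orbT.
have low_eq : (\sum_(j < q) i * 2 ^ j = i * 2 ^ q - i)%N.
  by rewrite -big_distrr /= sum_2pow mulnBr muln1.
rewrite low_eq in low.
have li : l = i.
  apply: val_inj; apply/eqP; rewrite /= eqn_leq il andbT.
  exact: weight_le q0 ik lk low tot_l.
rewrite {}li in Sl tot_l low Sjl *; split=> // j0; apply: val_inj => /=.
apply/eqP; rewrite eqn_leq Sjl andbT leqNgt; apply/negP => gt_j0.
have: (\sum_(j < q) i * 2 ^ j <
    \sum_(j < q) S (widen_ord (leqnSn q) j) i * 2 ^ j)%N.
  rewrite (bigD1 j0) // [ltnRHS](bigD1 j0) //= -addSn leq_add //.
    by rewrite ltn_pmul2r ?expn_gt0.
  by apply: leq_sum => j _; rewrite leq_mul2r Sjl orbT.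
by rewrite low_eq (weight_eq q0 ik tot_l) ltnn.
Qed.

(** A constraint is a mass with an ordered pair of hyperplanes; equal indices stand for bisection by
    one hyperplane. The last [t - 1] masses skip index 0. *)
Definition constrained q t k : pred ('I_(2 ^ q.+1 - 1) * ('I_k * 'I_k)) := fun x =>
  (x.2.1 <= x.2.2)%N && ((x.1 < 2 ^ q.+1 - t)%N || (0 < x.2.1)%N).
Definition constraint q t k := {x in @constrained q t k}.
Definition involves q t k (x : constraint q t k) (b : 'I_k) :=
  (b == (val x).2.1) || (b == (val x).2.2).

Lemma prod_constraints q t k (R : comNzRingType) (u : 'I_k.+1 -> R) :
  (0 < t)%N -> (t <= 2 ^ q)%N ->
  \prod_(x : constraint q t k.+1) \sum_(b | involves x b) u b =
  (\prod_(i : 'I_k.+1) \prod_(l : 'I_k.+1 | (i <= l)%N) pair_form u i l) ^+ (2 ^ q.+1 - t) *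
  (\prod_(i : 'I_k.+1 | (0 < i)%N) \prod_(l : 'I_k.+1 | (i <= l)%N) pair_form u i l)
    ^+ (t - 1).
Proof.
move=> t0 tq; set W0 := (X in X ^+ _ * _); set W1 := (X in _ * X ^+ _).
transitivity (\prod_(x in @constrained q t k.+1) pair_form u x.2.1 x.2.2).
  by rewrite [RHS]big_sub; apply: eq_bigr.
transitivity (\prod_(m < 2 ^ q.+1 - 1) if (m < 2 ^ q.+1 - t)%N then W0 else W1).
  rewrite (eq_bigl (fun p : 'I_(2 ^ q.+1 - 1) * ('I_k.+1 * 'I_k.+1) => predT p.1 &&
     [pred y : 'I_k.+1 * 'I_k.+1 | ((p.1 < 2 ^ q.+1 - t)%N || (0 < y.1)%N) && (y.1 <= y.2)%N] p.2));
    last by move=> p; rewrite inE /= andbC.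
  rewrite -(pair_big_dep predT (fun m : 'I_(2 ^ q.+1 - 1) =>
    [pred y : 'I_k.+1 * 'I_k.+1 | ((m < 2 ^ q.+1 - t)%N || (0 < y.1)%N) && (y.1 <= y.2)%N])
     (fun m y => pair_form u y.1 y.2)) /=.
  apply: eq_bigr => m _.
  rewrite -(pair_big_dep (fun i : 'I_k.+1 => (m < 2 ^ q.+1 - t)%N || (0 < i)%N)
    (fun i l : 'I_k.+1 => (i <= l)%N) (fun i l => pair_form u i l)) /=.
  by case: (m < _)%N.
transitivity (\prod_(0 <= m < 2 ^ q.+1 - 1) if (m < 2 ^ q.+1 - t)%N then W0 else W1).
  by rewrite big_mkord.
have q2 : (2 ^ q.+1 - t <= 2 ^ q.+1 - 1)%N by lia.
rewrite (big_cat_nat _ q2) //=; congr (_ * _).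
  rewrite (eq_big_nat _ _ (F2 := fun=> W0)) => [|m /andP[_ ->]//].
  by rewrite prodr_const_nat subn0.
rewrite (eq_big_nat _ _ (F2 := fun=> W1)) => [|m /andP[mt _]]; last first.
  by rewrite ltnNge mt.
rewrite prodr_const_nat; congr (_ ^+ _); rewrite expnS; lia.
Qed.

(** By Frobenius the product is one of sums over permutations, one sum for each binary digit.
    Removing the common shift [2 ^ q.+1 - t] from the exponents leaves the equations that only
    [id_rev_perms] solves. *)
Lemma constraint_count q t k : (0 < t)%N -> (t <= 2 ^ q)%N ->
  \big[addb/false]_(phi : {ffun constraint q t k.+1 -> 'I_k.+1})
    ([forall x, involves x (phi x)] &&
     [forall b, #|fibre phi b| == (2 ^ q * (k.+1 + 1) - t - b)%N]) = true.
Proof.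
move=> t0 tq; set n := fun b : 'I_k.+1 => (2 ^ q * (k.+1 + 1) - t - b)%N.
(* [B] must exceed the number of factors, the exponents [n b] and the exponents [w S i]. *)
pose B := (#|{: constraint q t k.+1}| + 2 ^ q * (k.+1 + 1) + 2 ^ q.+1 * k.+1).+1.
have nB b : (n b < B)%N by rewrite /n /B; lia.
apply: natr_F2_inj; rewrite -(@coef_prod_forms _ B _ _ n) //;
  last by rewrite /B ltnS -addnA leq_addr.
have char2 : 2%N \in [pchar {poly 'F_2}] by rewrite pchar_poly pchar_Fp.
rewrite prod_constraints // all_pair_forms // positive_pair_forms //.
have [bit [bit_q eA eC]] : exists bit : 'I_q.+1 -> bool, [/\ bit ord_max,
    (2 ^ q.+1 - t = \sum_j bit j * 2 ^ j)%N & (t - 1 = \sum_j ~~ bit j * 2 ^ j)%N].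
  by apply: binary_split; rewrite ?expnS; lia.
(* Where [bit j] holds, the digit belongs to [2 ^ q.+1 - t] and all permutations occur; elsewhere it
   belongs to [t - 1] and only those fixing [ord0] do. *)
pose ok j := [pred s : 'S_k.+1 | bit j || (s ord0 == ord0)].
pose w (S : {ffun 'I_q.+1 -> 'S_k.+1}) (i : 'I_k.+1) :=
  (\sum_j (S j i + bit j) * 2 ^ j)%N.
have wB S i : (w S i < B)%N.
  apply: (@leq_ltn_trans (2 ^ q.+1 * k.+1)%N); last by rewrite /B; lia.
  apply: (@leq_trans (\sum_(j < q.+1) k.+1 * 2 ^ j)%N).
    apply: leq_sum => j _; rewrite leq_mul2r; apply/orP; right.
    by have := ltn_ord (S j i); case: (bit j) => /=; lia.
  by rewrite -big_distrr /= sum_2pow mulnC leq_mul2r leq_subr orbT.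
transitivity ((\prod_(j < q.+1) \sum_(s | ok j s) \prod_i kvar B i ^+ ((s i + bit j) * 2 ^ j)%N)`_
    (\sum_b n b * B ^ b)%N).
  congr (nth _ (polyseq _) _); rewrite eA eC.
  rewrite !(big_morph _ (exprD _) (expr0 _)) -big_split /=; apply: eq_bigr => j _.
  rewrite /ok; case: (bit j) => /=; rewrite !mul1n !mul0n !expr0 ?mulr1 ?mul1r.
    rewrite sum_expr_2pow //; apply: eq_bigr => s _.
    by rewrite -prodrXl; apply: eq_bigr => i _; rewrite addn1 exprM.
  rewrite sum_expr_2pow //; apply: eq_bigr => s _.
  by rewrite -prodrXl; apply: eq_bigr => i _; rewrite addn0 exprM.
rewrite bigA_distr_big_dep coef_sum.
rewrite (eq_bigr (fun S => ([forall i, n i == w S i] : nat)%:R)) => [|S _]; last first.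
  rewrite exchange_big /= (eq_bigr (fun i => kvar B i ^+ w S i)) => [|i _].
    by rewrite prod_kvar coefXn digits_inj.
  by rewrite /w (big_morph _ (exprD _) (expr0 _)).
have wE (S : {ffun _}) i : (w S i = \sum_j S j i * 2 ^ j + (2 ^ q.+1 - t))%N.
  by rewrite eA -big_split /=; apply: eq_bigr => j _; rewrite mulnDl.
have nE (b : 'I_k.+1) : (n b = 2 ^ q * k - b + (2 ^ q.+1 - t))%N.
  rewrite /n expnS; have := ltn_ord b; have : (0 < 2 ^ q)%N by rewrite expn_gt0.
  nia.
pose S0 : {ffun 'I_q.+1 -> 'S_k.+1} := [ffun j => id_rev_perms k j].
(* [S0] is admissible: the identity fixes [ord0], and the reversal sits at the top digit, where
   [bit_q] admits every permutation. *)
rewrite (bigD1 S0) /=; last first.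
  apply/familyP => j; rewrite ffunE /id_rev_perms -topredE /=.
  by case: (j =P ord_max) => [->|_]; rewrite ?bit_q // perm1 eqxx orbT.
rewrite big1 ?addr0 => [|S /andP[_ SS0]].
  rewrite (_ : [forall i, _] = true) //; apply/forallP => i; rewrite nE wE.
  rewrite -(id_rev_perms_sum q i) eqn_add2r; apply/eqP.
  by apply: eq_bigr => j _; rewrite ffunE.
rewrite (_ : [forall i, _] = false) //; apply/forallP => nw; case/eqP: SS0.
apply/ffunP => j; rewrite ffunE; apply: id_rev_perms_unique => i.
by have := nw i; rewrite nE wE eqn_add2r => /eqP.
Qed.

End Counting.

(** * A Borsuk-Ulam theorem for products of projective spaces *)

Section BorsukUlam.
Import Order.TTheory GRing.Theory Num.Theory numFieldNormedType.Exports.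
Local Open Scope classical_set_scope.
Local Open Scope ring_scope.

Lemma increasing_seq_ge (f : nat -> nat) n : increasing_seq f -> (n <= f n)%N.
Proof.
move=> fi; elim: n => // n IH; apply: leq_ltn_trans IH _.
by have := leqW_mono fi n n.+1; rewrite ltnSn => ->.
Qed.

Lemma cvg_subsequence (T : topologicalType) (f : nat -> nat) (u : nat -> T) (l : T) :
  increasing_seq f -> u @ \oo --> l -> (u \o f) @ \oo --> l.
Proof.
move=> fi ul; apply: cvg_comp ul; apply/cvgnyPge => n; near=> p.
apply: leq_trans (increasing_seq_ge p fi); near: p; exact: nbhs_infty_ge.
Unshelve. all: by end_near. Qed.

Variable R : realType.

Lemma bolzano_weierstrass_fin (I : finType) (x : nat -> I -> R) :
  (forall n i, `|x n i| <= 1) ->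
  exists f : nat -> nat, increasing_seq f /\
    exists z : I -> R, forall i, (fun n => x (f n) i) @ \oo --> z i.
Proof.
move=> x1.
suff [f fi fc] : exists2 f : nat -> nat, increasing_seq f &
    forall i, i \in enum I -> cvgn (fun n => x (f n) i).
  exists f; split=> //; exists (fun i => limn (fun n => x (f n) i)) => i.
  by apply: fc; rewrite mem_enum.
elim: (enum I) => [|i s [f fi fc]]; first by exists id.
have [|g gi gc] := @bolzano_weierstrass R (fun n => x (f n) i).
  by exists 1; split=> // M M1 n _ /=; apply: le_trans (x1 _ _) (ltW M1).
exists (f \o g) => [n m /=|j]; first by rewrite fi; exact: gi.
rewrite in_cons => /predU1P[->//|/fc/cvg_ex[l jl]].
by apply/cvg_ex; exists l; exact: (cvg_subsequence gi jl).
Qed.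

Section Discrete.

Variables (m : nat) (K : finType) (blk : 'I_m -> K) (alpha : 'I_m -> K -> bool).
Variable F : 'I_m -> ('I_m -> R) -> R.

Definition flip (C : finType) (blk : C -> K) (b : K) (x : C -> R) : C -> R :=
  fun c => if blk c == b then - x c else x c.

Hypothesis F_flip : forall j b x, (forall c, `|x c| <= 1) ->
  (exists2 c, blk c = b & `|x c| = 1) ->
  F j (flip blk b x) = if alpha j b then - F j x else F j x.

Definition pt (L : nat) (v : gpoint m) (i : 'I_m) : R := (v i)%:R / L%:R - 1.

Lemma pt_le1 L (v : gpoint m) : (0 < L)%N -> [forall i, v i <= L.*2]%N ->
  forall i, `|pt L v i| <= 1.
Proof.
move=> L0 /forallP vL i; rewrite /pt ler_norml lerBrDr addrC subrr.
rewrite divr_ge0 ?ler0n //= lerBlDr ler_pdivrMr ?ltr0n //.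
by rewrite -[1 + 1]/(2%:R) -natrM ler_nat mul2n.
Qed.

(** At a zero of [F j] the value of [default] keeps the antipodal behaviour of the sign. *)
Definition sign_cochain L j (v : gpoint m) : bool :=
  if F j (pt L v) == 0 then default L blk (alpha j) v else 0 < F j (pt L v).

Lemma sign_cochain_type L j : (0 < L)%N ->
  has_type L blk (alpha j) (sign_cochain L j).
Proof.
move=> L0 b v bv; have [/forallP vL /existsP[c /andP[/eqP cb vc]]] := andP bv.
have L0' : L%:R != 0 :> R by rewrite pnatr_eq0 -lt0n.
have e : pt L (neg L blk b v) = flip blk b (pt L v).
  apply/funext => i; rewrite /pt /flip ffunE; case: ifP => // _.
  rewrite natrB ?vL // mulrBl -mul2n natrM mulfK //; ring.
have Fe : F j (pt L (neg L blk b v)) =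
    if alpha j b then - F j (pt L v) else F j (pt L v).
  rewrite e F_flip //; first by apply: pt_le1 => //; apply/forallP.
  exists c => //; rewrite /pt; case/orP: vc => /eqP->.
    by rewrite mul0r add0r normrN1.
  by rewrite -mul2n natrM mulfK // (_ : 2%:R - 1 = 1) ?normr1 //; ring.
rewrite /sign_cochain Fe; case: (boolP (alpha j b)) => ajb; last first.
  by rewrite default_type // (negPf ajb) !addbF.
rewrite oppr_eq0 default_type // ajb; case: eqP => // /eqP F0.
by rewrite oppr_gt0 addbT -leNgt le_eqVlt (negPf F0).
Qed.

(** A nonzero cup product has a flag on which all factors are nonzero; on its edge [j] the function
    [F j] vanishes at an end or changes sign. *)
Lemma sign_change L : (2 < L)%N -> ~~ odd L ->
  \big[addb/false]_(phi : {ffun 'I_m -> K})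
    ([forall j, alpha j (phi j)] && [forall b, #|fibre phi b| == #|fibre blk b|]) = true ->
  exists c : flag m L, forall j, exists l l', F j (pt L (vtx c l)) <= 0 <= F j (pt L (vtx c l')).
Proof.
move=> L2 Lev; have L0 : (0 < L)%N by apply: ltn_trans L2.
have st j : has_type L blk (alpha j) (sign_cochain L j) by apply: sign_cochain_type.
rewrite -(cup_count L2 Lev st) => cup1.
have [c /forallP all_neq] : exists c : flag m L,
    [forall j, ediff (sign_cochain L) val j (vtx c)].
  apply/existsP; case: (boolP [exists c, _]) => // /existsPn no.
  by rewrite /cup /tot big1 // in cup1 => c _; apply/negP; rewrite big_andE; apply/negP/no.
exists c => j; have := all_neq j; rewrite diff_neq /sign_cochain /=.
case: (F j (pt L (vtx c j)) =P 0) => [F0 _|/eqP F0]; first by exists j, j; rewrite F0 lexx.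
case: (F j (pt L (vtx c j.+1)) =P 0) => [F1 _|/eqP F1]; first by exists j.+1, j.+1; rewrite F1 lexx.
case: (ltgtP 0 (F j (pt L (vtx c j)))) F0 => //= h0 _.
  case: (ltgtP 0 (F j (pt L (vtx c j.+1)))) F1 => //= h1 _ _.
  by exists j.+1, j; rewrite !ltW.
case: (ltgtP 0 (F j (pt L (vtx c j.+1)))) F1 => //= h1 _ _.
by exists j, j.+1; rewrite !ltW.
Qed.

Hypothesis F_continuous : forall j (x : nat -> 'I_m -> R) z,
  (forall i, (fun n => x n i) @ \oo --> z i) -> (fun n => F j (x n)) @ \oo --> F j z.

Lemma borsuk_ulam_product_ord :
  \big[addb/false]_(phi : {ffun 'I_m -> K})
    ([forall j, alpha j (phi j)] && [forall b, #|fibre phi b| == #|fibre blk b|]) = true ->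
  exists z, forall j, F j z = 0.
Proof.
(* The meshes are even and larger than 2, as [sign_change] requires. *)
move=> cnt; pose L n := (n.+2.*2)%N.
have ex_c n : exists c : flag m (L n), forall j, exists l l',
    F j (pt (L n) (vtx c l)) <= 0 <= F j (pt (L n) (vtx c l')).
  by apply: sign_change cnt; rewrite /L ?odd_double //; lia.
pose c n := sval (cid (ex_c n)); have Hc n := svalP (cid (ex_c n)).
pose x n := pt (L n) [ffun i => (c n).1 i : nat].
have x1 n i : `|x n i| <= 1.
  by apply: pt_le1 => //; apply/forallP => k; rewrite ffunE ltnW.
have [f [fi [z xz]]] := bolzano_weierstrass_fin x1.
(* Each vertex is within [1 / L] of the corner of its cube, so every choice of vertices has the
   limit [z]. *)
have vtx_cvg (l : nat -> nat) i :
    (fun n => pt (L (f n)) (vtx (c (f n)) (l n)) i) @ \oo --> z i.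
  apply: cvg_sub0 (xz i).
  apply: (@squeeze_cvgr _ _ _ _ (fun=> 0) harmonic); [|exact: cvg_cst|exact: cvg_harmonic].
  apply: nearW => n; rewrite !fctE /x /pt !ffunE /= opprB addrA subrK -mulrBl.
  set w := nat_of_ord ((c (f n)).1 i); set v := (if _ then _ else _).
  have [e ev] : exists e : bool, v = (w + e)%N.
    by rewrite /v /odd_end /even_end; case: ifP => _; [exists (~~ odd w)|exists (odd w)].
  rewrite ev natrD addrC addKr divr_ge0 ?ler0n //=.
  apply: (@le_trans _ _ (1 / (L (f n))%:R)).
    by rewrite ler_wpM2r ?invr_ge0 ?ler0n // lern1 leq_b1.
  rewrite div1r lef_pV2 ?posrE ?ltr0n // ler_nat /L.
  by have := increasing_seq_ge n fi; lia.
exists z => j; have /choice[l Hl] := fun n => Hc (f n) j.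
have /choice[l' Hl'] := Hl.
have lim_vtx l0 : (fun n => F j (pt (L (f n)) (vtx (c (f n)) (l0 n)))) @ \oo --> F j z.
  by apply: (F_continuous (x := fun n => pt (L (f n)) (vtx (c (f n)) (l0 n)))).
apply/eqP; rewrite eq_le; apply/andP; split.
  apply: (cvgr_to_le (lim_vtx l)).
  by apply: nearW => n; have /andP[] := Hl' n.
apply: (cvgr_to_ge (lim_vtx l')).
by apply: nearW => n; have /andP[] := Hl' n.
Qed.

End Discrete.

(* The cube is a product of hemispheres indexed by [K]. The [addb] sum is the
   coefficient of the monomial with exponents [#|fibre blk b|] in the product over
   [j] of the sums of the variables [b] with [alpha j b], modulo 2. *)
Theorem borsuk_ulam_product (C J K : finType) (blk : C -> K) (alpha : J -> K -> bool)
    (F : J -> (C -> R) -> R) :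
  (forall j b x, (forall c, `|x c| <= 1) -> (exists2 c, blk c = b & `|x c| = 1) ->
    F j (flip blk b x) = if alpha j b then - F j x else F j x) ->
  (forall j (x : nat -> C -> R) z, (forall i, (fun n => x n i) @ \oo --> z i) ->
    (fun n => F j (x n)) @ \oo --> F j z) ->
  \big[addb/false]_(phi : {ffun J -> K}) ([forall j, alpha j (phi j)] &&
    [forall b, #|fibre phi b| == #|fibre blk b|]) = true ->
  exists z, forall j, F j z = 0.
Proof.
move=> F_flip F_cont cnt.
(* A nonzero count yields some [phi] with the prescribed fibre sizes; their sum equates the number
   of functions with the dimension, so one ordinal indexes both. *)
have JC : #|J| = #|C|.
  have [phi /andP[_ /forallP H]] : exists phi : {ffun J -> K},
      [forall j, alpha j (phi j)] &&
      [forall b, #|fibre phi b| == #|fibre blk b|].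
    apply/existsP; case: (boolP [exists phi, _]) => // /existsPn no.
    by rewrite big1 // in cnt => phi _; apply/negbTE/no.
  by rewrite -(sum_card_fibre phi) -(sum_card_fibre blk); apply: eq_bigr => b _; apply/eqP.
pose ej (j : 'I_#|C|) : J := enum_val (cast_ord (esym JC) j).
pose rj (x : J) : 'I_#|C| := cast_ord JC (enum_rank x).
have ejK : cancel ej rj by move=> j; rewrite /ej /rj enum_valK cast_ordKV.
have rjK : cancel rj ej by move=> j; rewrite /ej /rj cast_ordK enum_rankK.
have ej_bij : bijective ej by exists rj.
pose F' j (x : 'I_#|C| -> R) := F (ej j) (fun c => x (enum_rank c)).
have [|||z Hz] := @borsuk_ulam_product_ord _ _ (fun i => blk (enum_val i))
  (fun j => alpha (ej j)) F'.
- move=> j b x x1 [c cb xc]; rewrite /F' -F_flip //.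
    by congr (F _ _); apply/funext => c'; rewrite /flip enum_rankK.
  by exists (enum_val c); rewrite ?enum_valK.
- by move=> j x z xz; apply: F_cont => c; apply: xz.
- rewrite -[RHS]cnt (reindex (fun phi : {ffun J -> K} => [ffun j => phi (ej j)])) /=.
    apply: eq_bigr => phi _; congr (_ && _).
      apply/forallP/forallP => H j; last by rewrite ffunE.
      by have := H (rj j); rewrite ffunE rjK.
    apply: eq_forallb => b; congr (_ == _).
      rewrite -(on_card_preimset (R := fibre phi b) (f := ej)).
        by apply: eq_card => j; rewrite !inE ffunE.
      by apply: onW_bij.
    rewrite -(on_card_preimset (R := fibre blk b) (f := @enum_val _ C)).
      by apply: eq_card => j; rewrite !inE.
    by apply: onW_bij; apply: enum_val_bij.
  exists (fun psi : {ffun 'I_#|C| -> K} => [ffun x => psi (rj x)]) => phi _.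
    by apply/ffunP => j; rewrite !ffunE rjK.
  by apply/ffunP => j; rewrite !ffunE ejK.
exists (fun c => z (enum_rank c)) => j.
by rewrite -(Hz (rj j)) /F' rjK.
Qed.

End BorsukUlam.

(** * Integrals of signs *)

Section Signs.
Import Order.TTheory GRing.Theory Num.Theory numFieldNormedType.Exports.
Import measurable_realfun.
Local Open Scope classical_set_scope.
Local Open Scope ring_scope.

Variable R : realType.

Lemma measurable_sgr : measurable_fun [set: R] (Num.sg : R -> R).
Proof.
rewrite (_ : Num.sg = fun x : R => if x < 0 then -1 else if 0 < x then 1 else 0); last first.
  apply/funext => x; case: (ltgtP x 0) => [h|h|->]; last by rewrite sgr0.
    by rewrite ltr0_sg.
  by rewrite gtr0_sg.
apply: measurable_fun_ifT => //; first exact: measurable_fun_ltr.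
by apply: measurable_fun_ifT => //; exact: measurable_fun_ltr.
Qed.

Lemma normr_sg_le1 (x : R) : `|Num.sg x| <= 1.
Proof. by rewrite normr_sg lern1 leq_b1. Qed.

Variables (disp : measure_display) (T : measurableType disp).
Variable mu : {measure set T -> \bar R}.
Hypothesis mu_fin : (mu setT < +oo)%E.

Lemma bounded_integrable (g : T -> R) : measurable_fun setT g ->
  (forall u, `|g u| <= 1) -> mu.-integrable setT (EFin \o g).
Proof.
move=> mg g1; apply: measurable_bounded_integrable => //.
by exists 1; split=> // M M1 u _ /=; apply: le_trans (g1 u) (ltW M1).
Qed.

Lemma sg_integrable (f : T -> R) : measurable_fun setT f ->
  mu.-integrable setT (EFin \o (fun u => Num.sg (f u))).
Proof.
move=> mf; apply: bounded_integrable => [|u]; last exact: normr_sg_le1.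
exact: measurableT_comp measurable_sgr mf.
Qed.

Lemma sg_prod_measurable (f1 f2 : T -> R) : measurable_fun setT f1 ->
  measurable_fun setT f2 -> measurable_fun setT (fun u => Num.sg (f1 u) * Num.sg (f2 u)).
Proof.
move=> m1 m2; apply: measurable_funM; exact: measurableT_comp measurable_sgr _.
Qed.

Lemma sg_prod_integrable (f1 f2 : T -> R) : measurable_fun setT f1 ->
  measurable_fun setT f2 ->
  mu.-integrable setT (EFin \o (fun u => Num.sg (f1 u) * Num.sg (f2 u))).
Proof.
move=> m1 m2; apply: bounded_integrable => [|u]; first exact: sg_prod_measurable.
by rewrite normrM mulr_ile1 ?normr_ge0 ?normr_sg_le1.
Qed.

Definition closed_side (s : bool) (f : T -> R) : set T :=
  if s then [set u | 0 <= f u] else [set u | f u <= 0].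

Lemma measurable_closed_side s f : measurable_fun setT f -> measurable (closed_side s f).
Proof.
move=> mf; rewrite /closed_side; case: s.
  rewrite (_ : [set u | _] = f @^-1` `[0, +oo[);
    first by rewrite -[X in measurable X]setTI; exact: mf.
  by apply/seteqP; split=> u /=; rewrite in_itv /= andbT.
rewrite (_ : [set u | _] = f @^-1` `]-oo, 0]);
    first by rewrite -[X in measurable X]setTI; exact: mf.
by apply/seteqP; split=> u /=; rewrite in_itv /=.
Qed.

Lemma measurable_zero_set (f : T -> R) : measurable_fun setT f ->
  measurable [set u | f u = 0].
Proof.
move=> mf; rewrite -[X in measurable X]setTI.
exact: mf measurableT _ (measurable_set1 0).
Qed.

(* Off the zero sets, four times the indicator of a region is
   [(1 + s1 sg f1) (1 + s2 sg f2)]. *)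
Lemma quarter_of_sign_integrals (f1 f2 : T -> R) :
  measurable_fun setT f1 -> measurable_fun setT f2 ->
  mu [set u | f1 u = 0] = 0%E -> mu [set u | f2 u = 0] = 0%E ->
  \int[mu]_u Num.sg (f1 u) = 0 -> \int[mu]_u Num.sg (f2 u) = 0 ->
  \int[mu]_u (Num.sg (f1 u) * Num.sg (f2 u)) = 0 ->
  forall s1 s2, mu (closed_side s1 f1 `&` closed_side s2 f2) = (mu setT * (4%:R^-1)%:E)%E.
Proof.
move=> m1 m2 n1 n2 i1 i2 i12 s1 s2.
pose sgn (s : bool) : R := if s then 1 else -1.
pose A := closed_side s1 f1 `&` closed_side s2 f2.
have mA : measurable A by apply: measurableI; exact: measurable_closed_side.
pose g u := 4%:R^-1 + (4%:R^-1 * sgn s1 * Num.sg (f1 u) + (4%:R^-1 * sgn s2 * Num.sg (f2 u)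
  + 4%:R^-1 * (sgn s1 * sgn s2) * (Num.sg (f1 u) * Num.sg (f2 u)))).
have ms1 : measurable_fun setT (fun u => Num.sg (f1 u)) by exact: measurableT_comp measurable_sgr _.
have ms2 : measurable_fun setT (fun u => Num.sg (f2 u)) by exact: measurableT_comp measurable_sgr _.
have int_cst (r : R) : mu.-integrable setT (EFin \o (fun=> r)).
  apply: measurable_bounded_integrable => //.
  by exists `|r|; split=> // M rM u _ /=; exact: ltW.
have intZ (r : R) h : mu.-integrable setT (EFin \o h) ->
    mu.-integrable setT (EFin \o (fun u => r * h u)).
  by move=> ih; exact: (integrableZl measurableT r ih).
have intD h1 h2 : mu.-integrable setT (EFin \o h1) -> mu.-integrable setT (EFin \o h2) ->
    mu.-integrable setT (EFin \o (fun u => h1 u + h2 u)).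
  by move=> ih1 ih2; exact: (integrableD measurableT ih1 ih2).
have I1 := sg_integrable m1; have I2 := sg_integrable m2.
have I12 := sg_prod_integrable m1 m2.
have J1 := intZ (4%:R^-1 * sgn s1) _ I1; have J2 := intZ (4%:R^-1 * sgn s2) _ I2.
have J12 := intZ (4%:R^-1 * (sgn s1 * sgn s2)) _ I12.
have J := intD _ _ J1 (intD _ _ J2 J12).
have Ig : \int[mu]_u g u = 4%:R^-1 * fine (mu setT).
  rewrite /g RintegralD // RintegralD //; last exact: intD.
  rewrite RintegralD // !RintegralZl // i1 i2 i12 !mulr0 !addr0.
  by rewrite Rintegral_cst.
have mg : measurable_fun setT g.
  by apply/measurable_EFinP; exact: (measurable_int mu (intD _ _ (int_cst _) J)).
have Ag : (\int[mu]_u (\1_A u)%:E = \int[mu]_u (g u)%:E)%E.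
  apply: ae_eq_integral => //; [exact/measurable_EFinP|exact/measurable_EFinP|].
  exists ([set u | f1 u = 0] `|` [set u | f2 u = 0]); split.
  - by apply: measurableU; exact: measurable_zero_set.
  - by apply: null_set_setU => //; exact: measurable_zero_set.
  - move=> u /= H; apply: contrapT => /not_orP[/eqP h1 /eqP h2]; apply: H => _.
    congr EFin; rewrite indicE /g.
    have -> : (u \in A) = (if s1 then 0 <= f1 u else f1 u <= 0) &&
                          (if s2 then 0 <= f2 u else f2 u <= 0).
      apply/idP/andP; rewrite inE /A /closed_side /=; first by case: (s1) (s2) => -[] [].
      by case: (s1) (s2) => -[] [].
    rewrite /sgn; case: (ltgtP (f1 u) 0) h1 => // p1 _; case: (ltgtP (f2 u) 0) h2 => // p2 _;
    rewrite ?(gtr0_sg p1) ?(ltr0_sg p1) ?(gtr0_sg p2) ?(ltr0_sg p2);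
    by case: (s1) (s2) => -[] /=; field.
have finT : mu setT \is a fin_num by rewrite ge0_fin_numE.
rewrite -[X in mu X]setIT -/A -integral_indic // Ag.
rewrite -[LHS]fineK; last exact: (integrable_fin_num measurableT (intD _ _ (int_cst _) J)).
by rewrite -/(Rintegral mu setT g) Ig mulrC EFinM fineK.
Qed.

Lemma cvg_sgr (x : nat -> R) (l : R) : l != 0 -> x @ \oo --> l ->
  (Num.sg \o x) @ \oo --> Num.sg l.
Proof.
move=> l0 xl; apply: cvg_near_cst; case: (ltgtP l 0) l0 => // l0 _.
  near=> n; rewrite /= (ltr0_sg l0) ltr0_sg //; near: n.
  exact: cvgr_lt xl _ l0.
near=> n; rewrite /= (gtr0_sg l0) gtr0_sg //; near: n.
exact: cvgr_gt xl _ l0.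
Unshelve. all: by end_near. Qed.

(** Dominated convergence with bound 1: off the null zero sets of the limits, [Num.sg] is locally
    constant at the limit values. *)
Lemma cvg_sign_integral (g1 g2 : nat -> T -> R) (f1 f2 : T -> R) :
  (forall n, measurable_fun setT (g1 n)) -> (forall n, measurable_fun setT (g2 n)) ->
  measurable_fun setT f1 -> measurable_fun setT f2 ->
  (forall u, (fun n => g1 n u) @ \oo --> f1 u) ->
  (forall u, (fun n => g2 n u) @ \oo --> f2 u) ->
  mu [set u | f1 u = 0] = 0%E -> mu [set u | f2 u = 0] = 0%E ->
  (fun n => \int[mu]_u (Num.sg (g1 n u) * Num.sg (g2 n u))) @ \oo -->
    \int[mu]_u (Num.sg (f1 u) * Num.sg (f2 u)).
Proof.
move=> mg1 mg2 m1 m2 c1 c2 n1 n2.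
have [|||||_ _ H] := @dominated_convergence _ T R mu setT measurableT
    (fun n u => (Num.sg (g1 n u) * Num.sg (g2 n u))%:E)
    (fun u => (Num.sg (f1 u) * Num.sg (f2 u))%:E) (fun=> 1%:E).
- by move=> n; apply/measurable_EFinP; exact: sg_prod_measurable.
- by apply/measurable_EFinP; exact: sg_prod_measurable.
- exists ([set u | f1 u = 0] `|` [set u | f2 u = 0]); split.
  + by apply: measurableU; exact: measurable_zero_set.
  + by apply: null_set_setU => //; exact: measurable_zero_set.
  + move=> u /= H; apply: contrapT => /not_orP[/eqP h1 /eqP h2]; apply: H => _.
    apply: cvg_EFin; first exact: nearW.
    by apply: cvgM; exact: cvg_sgr.
- by apply: (bounded_integrable (g := fun=> 1)) => // u; rewrite normr1.
- apply: aeW => u n _; rewrite abse_EFin lee_fin.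
  by rewrite normrM mulr_ile1 ?normr_ge0 ?normr_sg_le1.
apply: fine_cvg; rewrite fineK //.
exact: (integrable_fin_num measurableT (sg_prod_integrable m1 m2)).
Qed.

End Signs.

(** * Masses vanish on hyperplanes *)

Section Hyperplanes.
Import Order.TTheory GRing.Theory Num.Theory numFieldNormedType.Exports.
Import measurable_realfun.
Local Open Scope classical_set_scope.
Local Open Scope ring_scope.

Variable R : realType.

Lemma measurable_affine d (a : d.-tuple R) b :
  measurable_fun setT (fun u : d.-tuple R => dotp u a - b).
Proof.
apply: measurable_funB => //; apply: measurable_sum => i.
by apply: measurable_funM => //; exact: measurable_tnth.
Qed.

Lemma measurable_box d (a b : d.-tuple R) : measurable (box a b).
Proof.
rewrite (_ : box a b = \bigcap_(i in [set: 'I_d]) [set u | tnth a i <= tnth u i < tnth b i]).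
  apply: fin_bigcap_measurable => // i _.
  rewrite (_ : [set u | _] = (fun u => tnth u i) @^-1` `[tnth a i, tnth b i[).
    by rewrite -[X in measurable X]setTI; exact: measurable_tnth.
  by apply/seteqP; split=> u /=; rewrite in_itv.
by apply/seteqP; split=> u H => [i _|i]; apply: H.
Qed.

(** The cover is continued by degenerate boxes. Their volume is 0 because the dimension is positive;
    an empty product would be 1. *)
Lemma lebesgue_null_finite_cover d (N : set (d.+1.-tuple R)) :
  (forall eps : R, 0 < eps -> exists (I : finType) (a b : I -> d.+1.-tuple R),
    [/\ forall x i, tnth (a x) i <= tnth (b x) i,
        N `<=` [set u | exists x, box (a x) (b x) u] &
        \sum_x box_vol (a x) (b x) <= eps]) ->
  lebesgue_null N.
Proof.
move=> H eps /H[I [a [b [ab Nab vol]]]].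
pose z : d.+1.-tuple R := [tuple 0 | i < d.+1].
pose pick_ (f : I -> d.+1.-tuple R) n :=
  if insub n is Some i then f (enum_val (i : 'I_#|I|)) else z.
exists (pick_ a), (pick_ b); split.
  by move=> n i; rewrite /pick_; case: insubP.
split.
  move=> u /Nab[x xu]; exists (enum_rank x) => //=.
  by rewrite /pick_ valK enum_rankK.
have vol0 n : 0 <= box_vol (pick_ a n) (pick_ b n).
  by apply: prodr_ge0 => i _; rewrite subr_ge0 /pick_; case: insubP.
apply: lime_le; first by apply: is_cvg_nneseries => n _ _; rewrite lee_fin.
apply: nearW => n; rewrite sumEFin lee_fin; apply: le_trans vol.
have [k nk] : exists k, (n <= #|I| + k)%N by exists n; rewrite leq_addl.
apply: (@le_trans _ _ (\sum_(0 <= i < #|I| + k) box_vol (pick_ a i) (pick_ b i))).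
  by rewrite (big_cat_nat (n := n) _ nk) //= lerDl sumr_ge0.
rewrite (big_cat_nat (n := #|I|)) ?leq_addr //= addrC big_nat_cond big1 ?add0r.
  rewrite big_mkord (reindex (@enum_rank I)) /=; last by apply: onW_bij; exact: enum_rank_bij.
  by rewrite le_eqVlt; apply/orP; left; apply/eqP/eq_bigr => x _; rewrite /pick_ valK enum_rankK.
move=> i /andP[/andP[Ii _] _]; rewrite /pick_ insubF ?ltnNge ?Ii //.
by rewrite /box_vol big_ord_recl subrr mul0r.
Qed.

(* In the first [d] coordinates the cube is cut into [M ^ d] cubes of side [h]; over each
   of them the hyperplane stays in an interval of length proportional to [h]. *)
Lemma lebesgue_null_hyperplane_box d (a : d.+1.-tuple R) (b c : R) (i : 'I_d.+1) :
  tnth a i != 0 -> 0 < c ->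
  lebesgue_null ([set u | dotp u a = b] `&`
    box [tuple - c | j < d.+1] [tuple c | j < d.+1]).
Proof.
move=> ai c0; apply: lebesgue_null_finite_cover => eps eps0.
(* [A] bounds the slope of the hyperplane as a graph over the coordinates other than [i]. *)
pose A := (\sum_j `|tnth a (lift i j)|) / `|tnth a i|.
have A0 : 0 <= A by rewrite divr_ge0 // sumr_ge0.
(* The boxes have total volume [(2 * c) ^+ d * (2 * A + 1) * h], which is at most [eps] once [M'.+1]
   exceeds [X]. *)
pose X := (2 * c) ^+ d * (2 * A + 1) * (2 * c) / eps.
have X0 : 0 <= X.
  apply: divr_ge0; last exact: ltW.
  apply: mulr_ge0; [apply: mulr_ge0; [apply: exprn_ge0|]|]; lra.
pose M' := Num.bound X; pose h := 2 * c / M'.+1%:R.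
have h0 : 0 < h by rewrite divr_gt0 ?mulr_gt0 ?ltr0n.
have Mh : M'.+1%:R * h = 2 * c by rewrite mulrC divfK // pnatr_eq0.
pose corner (g : {ffun 'I_d -> 'I_M'.+1}) j := - c + (g j)%:R * h.
pose mid g := (b - \sum_j corner g j * tnth a (lift i j)) / tnth a i.
pose lo g : d.+1.-tuple R :=
  [tuple if unlift i r is Some j then corner g j else mid g - A * h | r < d.+1].
(* The extra [h] provides the strict upper bound of a half-open box. *)
pose hi g : d.+1.-tuple R :=
  [tuple if unlift i r is Some j then corner g j + h else mid g + A * h + h | r < d.+1].
exists {ffun 'I_d -> 'I_M'.+1}, lo, hi; split.
- move=> g r; rewrite !tnth_mktuple; case: unliftP => [j|] _.
    by rewrite lerDl ltW.
  have := mulr_ge0 A0 (ltW h0); lra.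
- move=> u [/= ua ub].
  have uc r : - c <= tnth u r < c by have := ub r; rewrite !tnth_mktuple.
  pose fl j := Num.truncn ((tnth u (lift i j) + c) / h).
  have flP j : (fl j)%:R * h <= tnth u (lift i j) + c < (fl j)%:R * h + h.
    have := uc (lift i j) => /andP[u1 u2].
    have /truncn_itv/andP[f1 f2] : 0 <= (tnth u (lift i j) + c) / h.
      by rewrite divr_ge0 ?(ltW h0) // -lerBlDr sub0r.
    rewrite ler_pdivlMr // in f1; rewrite ltr_pdivrMr // in f2.
    by rewrite f1 /=; move: f2; rewrite -natr1 mulrDl mul1r.
  have flM j : (fl j < M'.+1)%N.
    rewrite -(ltr_nat R) -(ltr_pM2r h0) Mh.
    by have := flP j; have := uc (lift i j); lra.
  pose g := [ffun j => inord (fl j) : 'I_M'.+1].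
  have gE j : corner g j = - c + (fl j)%:R * h by rewrite /corner ffunE inordK.
  exists g => r; rewrite !tnth_mktuple; case: unliftP => [j ->|->].
    by rewrite gE; have := flP j; lra.
  have mid_dist : `|tnth u i - mid g| <= A * h.
    have -> : tnth u i - mid g =
        (\sum_j (corner g j - tnth u (lift i j)) * tnth a (lift i j)) / tnth a i.
      rewrite /mid -ua /dotp (bigD1_ord i) //=.
      under [X in _ = X / _]eq_bigr do rewrite mulrBl.
      by rewrite sumrB; field.
    rewrite normrM normfV /A mulrAC ler_pM2r ?invr_gt0 ?normr_gt0 //.
    apply: le_trans (ler_norm_sum _ _ _) _; rewrite big_distrl /=.
    apply: ler_sum => j _; rewrite normrM mulrC ler_wpM2l ?normr_ge0 //.
    by rewrite gE ler_norml; have := flP j; lra.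
  by move: mid_dist; rewrite ler_norml; lra.
- rewrite (eq_bigr (fun=> (2 * A + 1) * h * h ^+ d)) => [|g _]; last first.
    rewrite /box_vol (bigD1_ord i) //= !tnth_mktuple unlift_none; congr (_ * _); first ring.
    rewrite (eq_bigr (fun=> h)) => [|j _]; last first.
      by rewrite !tnth_mktuple liftK addrC addKr.
    by rewrite prodr_const card_ord.
  rewrite sumr_const card_ffun !card_ord -[leLHS]mulr_natr natrX.
  have -> : (2 * A + 1) * h * h ^+ d * M'.+1%:R ^+ d = (2 * c) ^+ d * (2 * A + 1) * h.
    by rewrite -Mh [(_ * h) ^+ d]exprMn; ring.
  rewrite /h mulrA ler_pdivrMr ?ltr0n // -ler_pdivrMl // mulrC -/X.
  apply: ltW; apply: lt_trans (archi_boundP X0) _.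
  by rewrite ltr_nat.
Qed.

Lemma mass_hyperplane d (mu : {measure set (d.-tuple R) -> \bar R}) (a : d.-tuple R) (b : R) :
  is_mass mu -> (exists i, tnth a i != 0) -> mu [set u | dotp u a - b = 0] = 0%E.
Proof.
case: d mu a => [|d] mu a [mu_fin mu_null] [i ai]; first by case: i ai.
have mH := measurable_zero_set (measurable_affine a b).
pose B n : set (d.+1.-tuple R) :=
  box [tuple - n.+1%:R | j < d.+1] [tuple n.+1%:R | j < d.+1].
pose HB n := [set u | dotp u a - b = 0] `&` B n.
have cover : [set u | dotp u a - b = 0] `<=` \bigcup_n HB n.
  move=> u ua; exists (Num.bound (\sum_r `|tnth u r|)) => //; split=> // r.
  have ur : `|tnth u r| < (Num.bound (\sum_r `|tnth u r|)).+1%:R.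
    apply: (@le_lt_trans _ _ (\sum_r `|tnth u r|)).
      by rewrite (bigD1 r) //= lerDl sumr_ge0.
    apply: lt_trans (archi_boundP _) _; first exact: sumr_ge0.
    by rewrite ltr_nat.
  by rewrite !tnth_mktuple; move: ur; rewrite ltr_norml; lra.
have mHB n : measurable (HB n) by apply: measurableI => //; exact: measurable_box.
have HB0 n : mu (HB n) = 0%E.
  apply: mu_null => //.
  have := @lebesgue_null_hyperplane_box d a b n.+1%:R i ai (ltr0Sn _ _).
  rewrite (_ : [set u | dotp u a = b] = [set u | dotp u a - b = 0]) //.
  apply/seteqP; split=> u /= /eqP; last by rewrite subr_eq0 => /eqP.
  by move=> e; apply/eqP; rewrite subr_eq0.
apply/eqP; rewrite eq_le measure_ge0 andbT.
have H := @measure_sigma_subadditive _ _ _ mu _ _ mHB mH cover.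
apply: (le_trans H).
by rewrite eseries0 // => n _ _; exact: HB0.
Qed.

End Hyperplanes.

(** * Parametrised arrangements of hyperplanes *)

Section Arrangement.
Import Order.TTheory GRing.Theory Num.Theory numFieldNormedType.Exports.
Import measurable_realfun.
Local Open Scope classical_set_scope.
Local Open Scope ring_scope.

Variables (R : realType) (k d : nat).

(* The [i]-th hyperplane ranges over the upper hemisphere of dimension [d - i]: its
   normal vector is supported on the first [d - i] coordinates, and its offset
   vanishes on the boundary of the cube. *)
Definition param := {i : 'I_k & 'I_(d - i)}.
Definition coord_of (i : 'I_k) (r : 'I_(d - i)) : param := Tagged (fun i : 'I_k => 'I_(d - i)) r.
Definition normal (x : param -> R) (i : 'I_k) : d.-tuple R :=
  [tuple if insub (r : nat) is Some r' then x (@coord_of i r') else 0 | r < d].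
Definition offset (x : param -> R) (i : 'I_k) : R := \prod_(r < d - i) (1 - x (coord_of r) ^+ 2).
Definition affine (x : param -> R) (i : 'I_k) (u : d.-tuple R) : R :=
  dotp u (normal x i) - offset x i.

Lemma card_fibre_tag (b : 'I_k) : #|fibre (@tag _ _ : param -> 'I_k) b| = (d - b)%N.
Proof.
rewrite -sum1_card (eq_bigl (fun c : param => (tag c == b) && true)) => [|c]; last first.
  by rewrite in_fibre andbT.
rewrite -(sig_big_dep (fun i : 'I_k => i == b) (fun i (_ : 'I_(d - i)) => true)
  (fun i _ => 1%N)) /=.
by rewrite big_pred1_eq sum1_card card_ord.
Qed.

(** The normal is odd in the parameters of its block; the offset is even and vanishes on the
    boundary. *)
Lemma affine_flip b x i u : (exists2 c : param, tag c = b & `|x c| = 1) ->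
  affine (flip (@tag _ _) b x) i u = if i == b then - affine x i u else affine x i u.
Proof.
move=> [c cb xc]; rewrite /affine /flip.
have normalE : normal (fun c => if tag c == b then - x c else x c) i =
    [tuple if i == b then - tnth (normal x i) r else tnth (normal x i) r | r < d].
  apply: eq_from_tnth => r; rewrite !tnth_mktuple.
  by case: insub => [r'|] /=; case: (i == b); rewrite ?oppr0.
have offsetE : offset (fun c => if tag c == b then - x c else x c) i = offset x i.
  by apply: eq_bigr => r _; case: ifP => _; rewrite ?sqrrN.
have dotpE : dotp u (normal (fun c => if tag c == b then - x c else x c) i) =
    if i == b then - dotp u (normal x i) else dotp u (normal x i).
  rewrite normalE /dotp; case: ifP => ib; last first.
    by apply: eq_bigr => r _; rewrite tnth_mktuple.
  by rewrite -sumrN; apply: eq_bigr => r _; rewrite tnth_mktuple mulrN.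
rewrite dotpE offsetE; case: eqP => // ib.
rewrite (_ : offset x i = 0) ?subr0 //.
move: cb xc; rewrite -ib; case: c => i' r /= ii'; case: _ / ii' r => r xr.
by rewrite /offset (bigD1 r) //= /coord_of -[x _ ^+ 2]real_normK ?num_real // xr expr1n subrr mul0r.
Qed.

Lemma cvg_affine (x : nat -> param -> R) z i u :
  (forall c, (fun n => x n c) @ \oo --> z c) ->
  (fun n => affine (x n) i u) @ \oo --> affine z i u.
Proof.
move=> xz; apply: cvgB.
  apply: cvg_big => [|r _]; first exact: add_continuous.
  apply: cvgM; first exact: cvg_cst.
  rewrite tnth_mktuple; under eq_fun do rewrite tnth_mktuple.
  by case: insub => [r'|]; [exact: xz|exact: cvg_cst].
apply: cvg_big => [|r _]; first exact: mul_continuous.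
by apply: cvgB; [exact: cvg_cst|apply: cvgM; exact: xz].
Qed.

Lemma measurable_affine_param x i : measurable_fun setT (affine x i).
Proof. exact: measurable_affine. Qed.

(** A zero normal means that all parameters of the block are 0, where the offset is 1. *)
Lemma affine_degenerate x i u : (forall r, tnth (normal x i) r = 0) -> affine x i u = -1.
Proof.
move=> x0; rewrite /affine /dotp big1 ?sub0r => [|r _]; last by rewrite x0 mulr0.
rewrite /offset big1 // => r _; have rd : (r < d)%N by have := ltn_ord r; lia.
have := x0 (Ordinal rd); rewrite tnth_mktuple /= valK => ->.
by rewrite expr0n /= subr0.
Qed.

Lemma normal_dec x i :
  (exists r, tnth (normal x i) r != 0) \/ (forall r, tnth (normal x i) r = 0).
Proof.
have [/existsP|/existsPn H] := boolP [exists r, tnth (normal x i) r != 0]; first by left.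
by right=> r; apply/eqP; rewrite -[_ == _]negbK; apply: H.
Qed.

Lemma mass_affine (mu : {measure set (d.-tuple R) -> \bar R}) x i :
  is_mass mu -> mu [set u | affine x i u = 0] = 0%E.
Proof.
move=> mmu; have [nz|z] := normal_dec x i; first exact: mass_hyperplane.
rewrite (_ : [set u | _] = set0) ?measure0 //; apply/seteqP; split=> // u /=.
by rewrite affine_degenerate // => /eqP; rewrite oppr_eq0 oner_eq0.
Qed.

(** The fallback makes this a hyperplane even for a zero normal, a case that [normal_neq0] excludes
    as soon as a nonzero mass has zero diagonal sign integral. *)
Definition hyperplane_of x i : d.-tuple R * R :=
  if [exists r, tnth (normal x i) r != 0] then (normal x i, offset x i) else ([tuple 1 | r < d], 0).

Lemma hyperplane_of_hyperplane x i : (0 < d)%N -> is_hyperplane (hyperplane_of x i).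
Proof.
move=> d0; rewrite /hyperplane_of; case: ifP => [/existsP //|_].
by exists (Ordinal d0); rewrite tnth_mktuple oner_neq0.
Qed.

(** The constant 1 lets one formula cover bisection by one hyperplane and the product of two
    signs. *)
Definition second_affine x i1 i2 : d.-tuple R -> R :=
  if i1 == i2 then fun=> 1 else affine x i2.
Definition sign_integral (mu : {measure set (d.-tuple R) -> \bar R}) x i1 i2 : R :=
  \int[mu]_u (Num.sg (affine x i1 u) * Num.sg (second_affine x i1 i2 u)).

Lemma measurable_second_affine x i1 i2 : measurable_fun setT (second_affine x i1 i2).
Proof. by rewrite /second_affine; case: ifP => // _; exact: measurable_affine. Qed.

Section Mass.

Variable mu : {measure set (d.-tuple R) -> \bar R}.
Hypothesis mmu : is_mass mu.

(** On the diagonal only the first factor changes sign, so the block counts once, as in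
    [involves]. *)
Lemma sign_integral_flip b x i1 i2 : (exists2 c : param, tag c = b & `|x c| = 1) ->
  sign_integral mu (flip (@tag _ _) b x) i1 i2 =
  if (b == i1) || (b == i2) then - sign_integral mu x i1 i2 else sign_integral mu x i1 i2.
Proof.
move=> bx; rewrite /sign_integral.
under eq_Rintegral do rewrite affine_flip //.
have int12 := sg_prod_integrable mmu.1 (measurable_affine_param x i1)
  (measurable_second_affine x i1 i2).
have second_flip u : Num.sg (second_affine (flip (@tag _ _) b x) i1 i2 u) =
    if (i1 != i2) && (i2 == b) then - Num.sg (second_affine x i1 i2 u)
    else Num.sg (second_affine x i1 i2 u).
  rewrite /second_affine; case: (i1 == i2) => //=.
  by rewrite affine_flip //; case: ifP => _; rewrite ?sgrN.
under eq_Rintegral do rewrite second_flip.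
have opp_int : \int[mu]_u (- (Num.sg (affine x i1 u) * Num.sg (second_affine x i1 i2 u))) =
    - \int[mu]_u (Num.sg (affine x i1 u) * Num.sg (second_affine x i1 i2 u)).
  rewrite -mulN1r -(RintegralZl (-1) measurableT int12).
  by apply: eq_Rintegral => u _; rewrite mulN1r.
rewrite -opp_int !(eq_sym b).
case: (i1 =P b) => [e1|n1] /=; case: (i2 =P b) => [e2|n2] /=; rewrite ?andbT ?andbF.
- by apply: eq_Rintegral => u _; rewrite e1 e2 eqxx /= sgrN mulNr.
- by apply: eq_Rintegral => u _; rewrite sgrN mulNr.
- rewrite (_ : i1 != i2) /=; last by apply/eqP => e; apply: n1; rewrite e.
  by apply: eq_Rintegral => u _; rewrite mulrN.
- by [].
Qed.

Lemma cvg_sign_integral_param (x : nat -> param -> R) z i1 i2 :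
  (forall c, (fun n => x n c) @ \oo --> z c) ->
  (fun n => sign_integral mu (x n) i1 i2) @ \oo --> sign_integral mu z i1 i2.
Proof.
move=> xz; apply: (cvg_sign_integral mmu.1) => //.
- by move=> n; exact: measurable_affine.
- by move=> n; exact: measurable_second_affine.
- exact: measurable_affine.
- exact: measurable_second_affine.
- by move=> u; exact: cvg_affine.
- move=> u; rewrite /second_affine; case: ifP => _; [exact: cvg_cst|exact: cvg_affine].
- exact: mass_affine.
- rewrite /second_affine; case: ifP => _; last exact: mass_affine.
  rewrite (_ : [set u | _] = set0) ?measure0 //; apply/seteqP; split=> // u /= /eqP.
  by rewrite oner_eq0.
Qed.

(** With a zero normal the integrand is -1 and the integral is minus the total mass. *)
Lemma normal_neq0 z i : mu setT != 0%E -> sign_integral mu z i i = 0 ->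
  exists r, tnth (normal z i) r != 0.
Proof.
move=> mu0 si; have [//|deg] := normal_dec z i; exfalso; move/eqP: si.
rewrite /sign_integral /second_affine eqxx.
under eq_Rintegral do rewrite affine_degenerate // sgrN !sgr1 mulr1.
rewrite Rintegral_cst // mulN1r oppr_eq0 fine_eq0 ?(negPf mu0) //.
by rewrite ge0_fin_numE //; exact: mmu.1.
Qed.

Lemma equipartition_of_zero z i1 i2 : i1 != i2 ->
  sign_integral mu z i1 i1 = 0 -> sign_integral mu z i2 i2 = 0 ->
  sign_integral mu z i1 i2 = 0 ->
  equipartition (hyperplane_of z i1) (hyperplane_of z i2) mu.
Proof.
move=> i12 s1 s2 s12 b1 b2.
have sideE b i : (exists r, tnth (normal z i) r != 0) ->
    halfspace b (hyperplane_of z i) = closed_side b (affine z i).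
  move=> /existsP nz; rewrite /hyperplane_of nz /halfspace /closed_side /affine.
  by case: b; apply/seteqP; split=> u /=; rewrite ?subr_ge0 ?subr_le0.
have halfspace_measurable b i : measurable (halfspace b (hyperplane_of z i)).
  rewrite (_ : halfspace _ _ = closed_side b (fun u =>
    dotp u (hyperplane_of z i).1 - (hyperplane_of z i).2)).
    by apply: measurable_closed_side; exact: measurable_affine.
  rewrite /halfspace /closed_side.
  by case: b; apply/seteqP; split=> u /=; rewrite ?subr_ge0 ?subr_le0.
(* A zero mass gives no control of the normals, but all its regions have measure 0. *)
have [mu0|mu0] := eqVneq (mu setT) 0%E.
  rewrite mu0 mul0e; apply/eqP; rewrite eq_le measure_ge0 andbT -mu0.
  by apply: le_measure; rewrite ?inE //; exact: measurableI.
have diag i : sign_integral mu z i i = \int[mu]_u Num.sg (affine z i u).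
  rewrite /sign_integral /second_affine eqxx.
  by apply: eq_Rintegral => u _; rewrite sgr1 mulr1.
rewrite (sideE b1) ?(sideE b2); try exact: normal_neq0.
apply: (quarter_of_sign_integrals mmu.1); rewrite -?diag //.
- exact: measurable_affine.
- exact: measurable_affine.
- exact: mass_affine.
- exact: mass_affine.
- by move: s12; rewrite /sign_integral /second_affine (negPf i12).
Qed.

End Mass.

End Arrangement.

(** * From the common zero to the equipartitions *)

Lemma equipartitionC (R : realType) d (H1 H2 : d.-tuple R * R) mu :
  equipartition H1 H2 mu -> equipartition H2 H1 mu.
Proof. by move=> H s1 s2; rewrite classical_sets.setIC; exact: H. Qed.

Local Open Scope classical_set_scope.
Local Open Scope ring_scope.

Theorem theorem3p1 (R : realType) (k q t : nat) :
  (2 <= k)%N -> (1 <= t)%N -> (t <= 2 ^ q)%N ->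
  forall mu : 'I_(2 ^ q.+1 - 1) ->
              {measure set ((2 ^ q * (k + 1) - t).-tuple R) -> \bar R},
  (forall m, is_mass (mu m)) ->
  exists H : 'I_k -> (2 ^ q * (k + 1) - t).-tuple R * R,
    (forall i, is_hyperplane (H i)) /\
    (forall (i j : 'I_k), i != j ->
       forall m : 'I_(2 ^ q.+1 - 1), (m < 2 ^ q.+1 - t)%N ->
         equipartition (H i) (H j) (mu m)) /\
    (forall (i j : 'I_k), (0 < i)%N -> (0 < j)%N -> i != j ->
       forall m : 'I_(2 ^ q.+1 - 1), (2 ^ q.+1 - t <= m)%N ->
         equipartition (H i) (H j) (mu m)).
Proof.
case: k => // k _ t1 tq mu mmu; set d := (2 ^ q * (k.+1 + 1) - t)%N in mu mmu *.
have d0 : (0 < d)%N.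
  by rewrite /d; have : (0 < 2 ^ q)%N; [rewrite expn_gt0|nia].
pose F (j : constraint q t k.+1) (x : param k.+1 d -> R) :=
  sign_integral (mu (val j).1) x (val j).2.1 (val j).2.2.
have [z Fz] : exists z, forall j, F j z = 0.
  apply: (@borsuk_ulam_product _ _ _ _ (@tag _ _ : param k.+1 d -> 'I_k.+1) (@involves q t k.+1)).
  - by move=> j b x _ bx; exact: sign_integral_flip.
  - by move=> j x y xy; exact: cvg_sign_integral_param.
  (* Block [b] has [d - b] parameters, which are the exponents of the monomial in
     [constraint_count]. *)
  - rewrite -[RHS](constraint_count k t1 tq); apply: eq_bigr => phi _; congr (_ && _).
    by apply: eq_forallb => b; rewrite card_fibre_tag.
have zero (m : 'I_(2 ^ q.+1 - 1)) (i1 i2 : 'I_k.+1) : (i1 <= i2)%N ->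
    (m < 2 ^ q.+1 - t)%N || (0 < i1)%N -> sign_integral (mu m) z i1 i2 = 0.
  move=> le12 mi; have c12 : (m, (i1, i2)) \in @constrained q t k.+1.
    by rewrite unfold_in /constrained /= le12.
  exact: (Fz (exist (fun x => x \in @constrained q t k.+1) _ c12)).
have equi (m : 'I_(2 ^ q.+1 - 1)) (i1 i2 : 'I_k.+1) : i1 != i2 ->
    (m < 2 ^ q.+1 - t)%N || ((0 < i1) && (0 < i2))%N ->
    equipartition (hyperplane_of z i1) (hyperplane_of z i2) (mu m).
  (* Constraints exist only for ordered pairs, while equipartition is symmetric. *)
  wlog lt12 : i1 i2 / (i1 < i2)%N => [wl|] i12 mi.
    case: (ltngtP i1 i2) (i12) => [lt12|lt21|/val_inj->]; rewrite ?eqxx // => _.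
      exact: wl.
    by apply: equipartitionC; apply: wl; rewrite 1?eq_sym // andbC.
  have [m1 m2] : ((m < 2 ^ q.+1 - t)%N || (0 < i1)%N) /\ ((m < 2 ^ q.+1 - t)%N || (0 < i2)%N).
    by case/orP: mi => [->//|/andP[-> ->]]; rewrite !orbT.
  by apply: equipartition_of_zero => //; apply: zero => //; exact: ltnW.
exists (hyperplane_of z); split; [|split].
- by move=> i; exact: hyperplane_of_hyperplane.
- by move=> i j ij m mt; apply: equi => //; rewrite mt.
- by move=> i j i0 j0 ij m _; apply: equi => //; rewrite i0 j0 orbT.
Qed.
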